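(* Let $(I(t))_{t\ge 0}$ be an admissible family on $C_\kappa$ (see context) with constants $\omega\ge 0$, $t_0>0$, $\epsilon_0\in(0,1]$, $L\ge 0$ and step sizes $(h_n)_{n\in\mathbb N}$, and let $(S(t))_{t\ge 0}$ be the associated semigroup. Suppose there is a function $\rho_1\colon\mathbb R_+^2\to\mathbb R_+$, non-decreasing in both arguments, with $$\|I(h_n)f-f\|_\kappa\le\rho_1\big(d^{-1/2}\|Df\|_\infty,\,d^{-1}\|D^2f\|_\infty\big)h_n\quad\text{for all } n\in\mathbb N,\ f\in C_b^\infty,$$ and that there exist $a_1\colon\mathbb R_+\to\mathbb R_+$ and $a_2,p\ge 0$ with $$\rho_1(x_1,x_2)\le a_1(x_1)+a_2x_2^p\quad\text{for all } x_1,x_2\ge 1 .$$ Then, for every $r\ge 1$, $T\ge 0$, $f\in\mathrm{Lip}_b(r)$, $k,l,n\in\mathbb N$ with $kh_n,lh_n\in[0,T]$ and $|k-l|h_n\le 1$, and $s,t\in[0,T]$ with $|s-t|\le 1$, $$\|I(h_n)^kf-I(h_n)^lf\|_\kappa\le c_{r,T}(|k-l|h_n)^\alpha,$$ $$\|I(\pi_n^s)f-I(\pi_n^t)f\|_\kappa\le c_{r,T}(|s-t|+h_n)^\alpha,$$ $$\|S(s)f-S(t)f\|_\kappa\le c_{r,T}|s-t|^\alpha,$$ where $c_{r,T}:=e^{\omega T}\big(2r+a_1(r)+a_2b_{0,1}^pr^p\big)$ and $\alpha:=\frac1{1+p}$.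
   Context: Spaces. $\kappa\colon\mathbb R^d\to(0,1]$ is continuous with $c_\kappa:=\sup_{x\in\mathbb R^d}\sup_{|y|\le 1}\kappa(x)/\kappa(x-y)<\infty$. $C_\kappa$ is the space of continuous $f\colon\mathbb R^d\to\mathbb R$ with $\|f\|_\kappa:=\sup_x|f(x)|\kappa(x)<\infty$, endowed with the mixed topology: a sequence $f_n\to f$ in $C_\kappa$ iff $\sup_n\|f_n\|_\kappa<\infty$ and $f_n\to f$ uniformly on compact sets. All limits in $C_\kappa$ are in this sense; inequalities between functions are pointwise; $\|f\|_\infty=\sup|f|$; $|\cdot|$ is the Euclidean norm; $\mathbb R_+=[0,\infty)$; $B_{\mathbb R^d}(r)$ is the closed ball of radius $r$. $\mathrm{Lip}_b(r)$ is the set of $r$-Lipschitz $f\colon\mathbb R^d\to\mathbb R$ with $\|f\|_\infty\le r$. $C_b^\infty$ is the set of bounded smooth functions on $\mathbb R^d$ with all partial derivatives bounded; $\|D^lf\|_\infty:=\big\|\big(\sum_{|\gamma|=l}|D^\gamma f|^2\big)^{1/2}\big\|_\infty$ (sum over multi-indices), $D=D^1$. $(\tau_xf)(y):=f(x+y)$. Admissible family. $(h_n)_{n\in\mathbb N}\subset(0,1]$ with $h_n\to 0$. For operators $I(t)\colon C_\kappa\to C_\kappa$, $t\ge 0$, put $I(\pi_n^t):=I(h_n)^{k_n^t}$ with $k_n^t:=\max\{k\in\mathbb N_0: kh_n\le t\}$ (so $I(\pi_n^t)f=f$ for $t<h_n$), and $I'(0)f:=\lim_{h\downarrow 0}(I(h)f-f)/h\in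 C_\kappa$ whenever this limit exists. The family is called admissible with constants $\omega,t_0,\epsilon_0,L$ if: (1) $I(0)=\mathrm{id}$; (2) each $I(t)$ is convex and monotone with $I(t)0=0$; (3) $\|I(t)f-I(t)g\|_\kappa\le e^{\omega t}\|f-g\|_\kappa$ for all $t\in[0,1]$, $f,g\in C_\kappa$; (4) $\|I(t)(\tau_xf)-\tau_xI(t)f\|_\kappa\le Lrt|x|$ for all $t\in[0,t_0]$, $x\in B_{\mathbb R^d}(\epsilon_0)$, $r\ge 0$, $f\in\mathrm{Lip}_b(r)$; (5) for every $f\in C_b^\infty$, $I'(0)f\in C_\kappa$ exists and there are $c\ge 0$, $s_0>0$ with $\|I(t)f-f\|_\kappa\le ct$ for $t\in[0,s_0]$; (6) for every $t\ge 0$, compact $K\subset\mathbb R^d$ and $(f_k)\subset C_\kappa$ with $f_k\downarrow 0$, $\sup_{(s,x)\in[0,t]\times K}\sup_n(I(\pi_n^s)f_k)(x)\downarrow 0$ as $k\to\infty$; (7) $I(t)\colon\mathrm{Lip}_b(r)\to\mathrm{Lip}_b(e^{\omega t}r)$ for all $r,t\ge 0$. Associated semigroup. For an admissible family it is known that $S(t)f:=\lim_{n\to\infty}I(\pi_n^t)f$ exists for all $t\ge 0$, $f\in C_\kappa$ and defines a strongly continuous convex monotone semigroup on $C_\kappa$ with $S(t)0=0$. Constant. $\eta\colon\mathbb R_+\times\mathbb R^d\to\mathbb R_+$ is a fixed infinitely differentiable function with support in $[0,1]\times B_{\mathbb R^d}(1)$ and integral $1$, and $b_{0,1}:=\max_{|\alpha|=1}\|D^\alpha\eta\|_{L^1(\mathbb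 R_+\times\mathbb R^d)}$, where $D^\alpha$ acts in the space variable. *)

(* Defs.v *)
From HB Require Import structures.
From mathcomp Require Import all_boot all_order all_algebra.
From mathcomp Require Import all_classical all_reals all_analysis.
Set Implicit Arguments.
Unset Strict Implicit.
Unset Printing Implicit Defensive.
Import Order.TTheory GRing.Theory Num.Theory.
Import numFieldNormedType.Exports.
Local Open Scope classical_set_scope.
Local Open Scope ring_scope.

Lemma sigma_finite_product d1 d2 (T1 : measurableType d1)
    (T2 : measurableType d2) (R : realType)
    (m1 : {sigma_finite_measure set T1 -> \bar R})
    (m2 : {sigma_finite_measure set T2 -> \bar R}) :
  sigma_finite setT (m1 \x m2)%E.
Proof.
have /sigma_finiteP[F [TF ndF Foo]] := sigma_finiteT m1.
have /sigma_finiteP[G [TG ndG Goo]] := sigma_finiteT m2.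
exists (fun n => F n `*` G n).
  rewrite -setXTT TF TG predeqE => -[x y]; split.
    move=> [/= [n _ Fnx] [k _ Gky]]; exists (maxn n k) => //; split.
    - by move: x Fnx; exact/subsetPset/ndF/leq_maxl.
    - by move: y Gky; exact/subsetPset/ndG/leq_maxr.
  by move=> [n _ []/= ? ?]; split; exists n.
move=> k; have [? ?] := Foo k; have [? ?] := Goo k.
split; first exact: measurableX.
by rewrite product_measure1E// lte_mul_pinfty// ge0_fin_numE.
Qed.

(* Lebesgue measure on R^n, as the n-fold product of [lebesgue_measure] on
   [n.-tuple R] with its product sigma-algebra. *)
Section lebesgue_step.
Context (R : realType) (n : nat).
Variable mu : {sigma_finite_measure set (n.-tuple (measurableTypeR R)) -> \bar R}.

Definition tuple_cons (z : measurableTypeR R * n.-tuple (measurableTypeR R)) :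
  n.+1.-tuple (measurableTypeR R) := [the n.+1.-tuple _ of z.1 :: z.2].

Lemma measurable_tuple_cons : measurable_fun setT tuple_cons.
Proof. by apply: measurable_cons; [exact: measurable_fst|exact: measurable_snd]. Qed.

Definition lebesgue_step : set (n.+1.-tuple (measurableTypeR R)) -> \bar R :=
  pushforward (@lebesgue_measure R \x mu)%E tuple_cons.

Let step0 : lebesgue_step set0 = 0%E.
Proof. by rewrite /lebesgue_step /pushforward preimage_set0 measure0. Qed.

Let step_ge0 A : (0 <= lebesgue_step A)%E.
Proof. by rewrite /lebesgue_step /pushforward measure_ge0. Qed.

Let step_sigma_additive : semi_sigma_additive lebesgue_step.
Proof.
move=> F mF tF mUF; rewrite /lebesgue_step /pushforward preimage_bigcup.
have mc := measurable_tuple_cons.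
apply: measure_semi_sigma_additive.
- by move=> i; rewrite -[X in measurable X]setTI; exact: mc.
- apply/trivIsetP => /= i j _ _ ij; rewrite -preimage_setI.
  by move/trivIsetP : tF => /(_ _ _ _ _ ij) ->//; rewrite preimage_set0.
- by rewrite -preimage_bigcup -[X in measurable X]setTI; exact: mc.
Qed.

HB.instance Definition _ :=
  isMeasure.Build _ _ _ lebesgue_step step0 step_ge0 step_sigma_additive.

Let step_sigma_finite : sigma_finite setT lebesgue_step.
Proof.
have [F FT mF] := sigma_finite_product (@lebesgue_measure R) mu.
pose u := fun z : n.+1.-tuple (measurableTypeR R) =>
  (thead z, [tuple of behead z] : n.-tuple (measurableTypeR R)).
have mu' : measurable_fun setT u.
  apply: measurable_fun_pair; first exact: measurable_tnth.
  exact: measurable_behead.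
have uK : cancel tuple_cons u.
  by case=> x y; rewrite /u /tuple_cons /= theadE; congr pair; exact/val_inj.
exists (fun k => u @^-1` F k).
  by rewrite -preimage_bigcup -FT preimage_setT.
move=> k; have [mFk Fk] := mF k; split.
  by rewrite -[X in measurable X]setTI; exact: mu'.
rewrite /lebesgue_step /pushforward -comp_preimage.
rewrite (_ : (u \o tuple_cons) @^-1` F k = F k)//.
by apply/seteqP; split => z /=; rewrite uK.
Qed.

HB.instance Definition _ :=
  Measure_isSigmaFinite.Build _ _ _ lebesgue_step step_sigma_finite.

End lebesgue_step.

Fixpoint lebesgue_tuple (R : realType) (n : nat) :
    {sigma_finite_measure set (n.-tuple (measurableTypeR R)) -> \bar R} :=
  match n with
  | 0 => \d_([tuple] : 0.-tuple (measurableTypeR R))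
  | n'.+1 => lebesgue_step (lebesgue_tuple R n')
  end.

Definition row_of_tuple (R : realType) (d : nat)
  (z : d.-tuple (measurableTypeR R)) : 'rV[R]_d := \row_i tnth z i.

Section spaces.
Context (R : realType) (d : nat).
Implicit Types (x y : 'rV[R]_d) (f g : 'rV[R]_d -> R) (kappa : 'rV[R]_d -> R).

(* The library norm on ['rV[R]_d] is the maximum norm; the topologies agree. *)
Definition enorm x : R := Num.sqrt (\sum_(i < d) x ord0 i ^+ 2).

Definition translate x f : 'rV[R]_d -> R := fun y => f (x + y).

Definition sup_norm f : \bar R := ereal_sup (range (fun x => `|f x|%:E)).

Definition kappa_norm kappa f : \bar R :=
  ereal_sup (range (fun x => (`|f x| * kappa x)%:E)).

Record is_weight kappa : Prop := IsWeight {
  weight_continuous : continuous kappa;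
  weight_itv : forall x, 0 < kappa x <= 1;
  weight_ratio : (ereal_sup [set r | exists x y,
    enorm y <= 1 /\ r = (kappa x / kappa (x - y))%:E]%R < +oo)%E }.

Definition C_kappa kappa : set ('rV[R]_d -> R) :=
  [set f | continuous f /\ (kappa_norm kappa f < +oo)%E].

Definition mixed_cvg kappa (u : nat -> 'rV[R]_d -> R) g : Prop :=
  (ereal_sup (range (fun n => kappa_norm kappa (u n))) < +oo)%E /\
  (forall K : set 'rV[R]_d, compact K -> {uniform K, u @ \oo --> g}).

Definition Lip_b (r : R) : set ('rV[R]_d -> R) :=
  [set f | (forall x y, `|f x - f y| <= r * enorm (x - y)) /\
           (sup_norm f <= r%:E)%E].

Definition pderive (i : 'I_d) f : 'rV[R]_d -> R := 'D_(delta_mx ord0 i) f.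

Definition pderives (s : seq 'I_d) f : 'rV[R]_d -> R := foldr pderive f s.

Definition smooth f : Prop := forall s : seq 'I_d,
  continuous (pderives s f) /\
  (forall i x, derivable (pderives s f) x (delta_mx ord0 i)).

Definition Cb_smooth : set ('rV[R]_d -> R) :=
  [set f | smooth f /\
           forall s : seq 'I_d, (sup_norm (pderives s f) < +oo)%E].

(* Every multi-index of order [l] has entries at most [l]. *)
Definition multi_index (l : nat) : pred {ffun 'I_d -> 'I_l.+1} :=
  fun a => (\sum_i a i)%N == l.

Definition Dmulti (l : nat) (a : {ffun 'I_d -> 'I_l.+1}) f : 'rV[R]_d -> R :=
  pderives (flatten [seq nseq (a i) i | i <- enum 'I_d]) f.

Definition Dnorm (l : nat) f : \bar R :=
  sup_norm (fun x => Num.sqrt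
    (\sum_(a : {ffun 'I_d -> 'I_l.+1} | multi_index a) (Dmulti a f x) ^+ 2)).

End spaces.

Section operators.
Context (R : realType) (d : nat).
Implicit Types (kappa : 'rV[R]_d -> R) (f g : 'rV[R]_d -> R) (h : nat -> R)
  (I S : R -> ('rV[R]_d -> R) -> 'rV[R]_d -> R).

(* For [0 <= t] and [0 < hn], the largest [k] with [k * hn <= t]: see
   [nstepsP]. *)
Definition nsteps (hn t : R) : nat := Num.truncn (t / hn).

Lemma nstepsP (hn t : R) (k : nat) : 0 < hn -> 0 <= t ->
  (k <= nsteps hn t)%N = (k%:R * hn <= t).
Proof.
by move=> h0 t0; rewrite /nsteps truncn_ge_nat ler_pdivlMr ?mul0r.
Qed.

Definition I_pi I h (n : nat) (t : R) f : 'rV[R]_d -> R :=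
  iter (nsteps (h n) t) (I (h n)) f.

(* [g = lim_(s -> 0+) (I(s) f - f) / s]. The mixed topology is specified by its
   convergent sequences, so the limit is taken along all null sequences. *)
Definition is_generator kappa I f g : Prop :=
  forall s : nat -> R, (forall n, 0 < s n) -> s @ \oo --> 0 ->
    mixed_cvg kappa (fun n x => (I (s n) f x - f x) / s n) g.

Record step_sizes h : Prop := StepSizes {
  step_itv : forall n, 0 < h n <= 1;
  step_cvg0 : h @ \oo --> 0 }.

Record admissible kappa h (omega t0 eps0 L : R) I : Prop := Admissible {
  adm_stable : forall (t : R) f, 0 <= t -> C_kappa kappa f -> C_kappa kappa (I t f);
  adm_id : forall f, C_kappa kappa f -> I 0 f = f;
  adm_convex : forall (t l : R) f g, 0 <= t -> 0 <= l <= 1 ->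
    C_kappa kappa f -> C_kappa kappa g -> forall x,
    I t (fun y => l * f y + (1 - l) * g y) x <= l * I t f x + (1 - l) * I t g x;
  adm_monotone : forall (t : R) f g, 0 <= t -> C_kappa kappa f -> C_kappa kappa g ->
    (forall x, f x <= g x) -> forall x, I t f x <= I t g x;
  adm_zero : forall t : R, 0 <= t -> I t (fun=> 0) = (fun=> 0);
  adm_lipschitz : forall (t : R) f g, 0 <= t <= 1 ->
    C_kappa kappa f -> C_kappa kappa g ->
    (kappa_norm kappa (I t f \- I t g)%R <=
       (expR (omega * t))%:E * kappa_norm kappa (f \- g)%R)%E;
  adm_translate : forall (t : R) x (r : R) f, 0 <= t <= t0 -> enorm x <= eps0 -> 0 <= r ->
    Lip_b r f ->
    (kappa_norm kappa (I t (translate x f) \- translate x (I t f))%R <=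
       (L * r * t * enorm x)%:E)%E;
  adm_generator : forall f, Cb_smooth f ->
    (exists2 g, C_kappa kappa g & is_generator kappa I f g) /\
    (exists c s0 : R, [/\ 0 <= c, 0 < s0 & forall t : R, 0 <= t <= s0 ->
      (kappa_norm kappa (I t f \- f)%R <= (c * t)%:E)%E]);
  (* [K] is nonempty because [ereal_sup set0 = -oo]. *)
  adm_continuous : forall (t : R) (K : set 'rV[R]_d) (f : nat -> 'rV[R]_d -> R),
    0 <= t -> compact K -> K !=set0 -> (forall k, C_kappa kappa (f k)) ->
    (forall x, nonincreasing_seq (fun k => f k x)) ->
    (forall x, f ^~ x @ \oo --> 0) ->
    let m := fun k => ereal_sup [set y | exists (s : R) x n,
      [/\ 0 <= s <= t, K x & y = (I_pi I h n s (f k) x)%:E]] in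
    nonincreasing_seq m /\ m @ \oo --> 0%E;
  adm_Lip : forall (r t : R) f, 0 <= r -> 0 <= t -> Lip_b r f ->
    Lip_b (expR (omega * t) * r) (I t f) }.

Definition is_associated_semigroup kappa h I S : Prop :=
  forall (t : R) f, 0 <= t -> C_kappa kappa f ->
    mixed_cvg kappa (fun n => I_pi I h n t f) (S t f).

End operators.

Section mollifier.
Context (R : realType) (d : nat).
Implicit Type eta : R -> 'rV[R]_d -> R.

Definition half_space : set (measurableTypeR R * d.-tuple (measurableTypeR R)) :=
  [set z | (0 : R) <= z.1].

(* Smoothness up to the boundary [t = 0]: [eta] is the restriction of a smooth
   function on R^(1 + d). The values of [eta] at negative times are irrelevant. *)
Record is_mollifier eta : Prop := IsMollifier {
  mol_smooth : exists2 g : 'rV[R]_(1 + d) -> R, smooth g &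
    forall (t : R) x, 0 <= t -> g (row_mx (t%:M : 'rV[R]_1) x) = eta t x;
  mol_ge0 : forall (t : R) x, 0 <= t -> 0 <= eta t x;
  mol_support : forall (t : R) x, 0 <= t -> eta t x != 0 -> t <= 1 /\ enorm x <= 1;
  mol_integral : (\int[@lebesgue_measure R \x lebesgue_tuple R d]_(z in half_space)
    (eta z.1 (row_of_tuple z.2))%:E = 1)%E }.

Definition space_deriv_L1 eta (a : {ffun 'I_d -> 'I_2}) : \bar R :=
  (\int[@lebesgue_measure R \x lebesgue_tuple R d]_(z in half_space)
    `|(Dmulti a (eta z.1) (row_of_tuple z.2))%:E|)%E.

Definition b01 eta : R :=
  fine (\big[maxe/0%E]_(a : {ffun 'I_d -> 'I_2} | multi_index a) space_deriv_L1 eta a).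

End mollifier.

(* Main.v *)
(* Mollify [f] at scale [delta] with [eta]: the mollification [g] satisfies
   [|g - f| <= r delta], its first derivatives are at most [r], and its second
   derivatives are at most [r b01 / delta], since one derivative can be moved
   onto [eta].  With [m] steps of length [hn] and [tau = m hn <= 1], inserting [g]
   gives [||I(hn)^m f - f|| <= e^(omega tau) (2 r delta + tau rho1 (r, r b01 / delta))],
   and [delta = tau^(1 / (1 + p))] balances the two terms.  The growth bound
   on [rho1] applies because [b01 >= 1].  For [tau > 1], which rounding can
   produce in the second estimate, the trivial bound [2 r e^(omega T)] suffices.
   The third estimate is the pointwise limit of the second. *)
Require Import Defs.
From mathcomp Require Import all_boot all_order all_algebra.
From mathcomp Require Import all_classical all_reals all_analysis.
From mathcomp Require Import measurable_realfun ring lra.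
Import Order.TTheory GRing.Theory Num.Theory.
Import numFieldNormedType.Exports.
Set Implicit Arguments.
Unset Strict Implicit.
Unset Printing Implicit Defensive.
Local Open Scope classical_set_scope.
Local Open Scope ring_scope.

(** * Measurability and translation invariance on tuples *)

(** Since [f] is merely Lipschitz, an increment of the argument must be transferred to the kernel
    before differentiating; this change of variables rests on translation invariance of
    [lebesgue_tuple], built up from dimension one by Tonelli. For second derivatives only one of the
    two derivatives goes onto [eta]; the other is paid for by the Lipschitz constant of [f]. Moving
    both would cost [delta^-2] and lower the exponent to [1 / (1 + 2 p)]. The choice of [delta]
    solves [tau delta^-p = delta]. The factors [d^(-1/2)] and [d^-1] in the arguments of [rho1]
    absorb the number of multi-indices, at most [d^l] of order [l]. No constant depends on the step
    size, so the estimates survive the limit [h n --> 0]. *)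

Lemma cvg_rowP (R : realType) n (u : nat -> 'rV[R]_n) (l : 'rV[R]_n) :
  (forall i, u k ord0 i @[k --> \oo] --> l ord0 i) -> u @ \oo --> l.
Proof.
move=> ul; apply/cvg_ballP => e e0.
suff : \forall k \near \oo, forall i, ball (l ord0 i) e (u k ord0 i).
  by apply: filterS => k H; split => // i j; rewrite !ord1; exact: H.
have : \forall k \near \oo, forall i, i \in enum 'I_n -> ball (l ord0 i) e (u k ord0 i).
  elim: (enum 'I_n) => [|j s IH]; first exact: nearW.
  have := ul j => /cvg_ballP/(_ e e0) Hj.
  apply: filterS2 Hj IH => k Hj IH i; rewrite inE => /predU1P[->//|]; exact: IH.
by apply: filterS => k H i; apply: H; rewrite mem_enum.
Qed.

Lemma floor_scaled_cvg (R : realType) (x : R) :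
  (Num.floor (k.+1%:R * x))%:~R / k.+1%:R @[k --> \oo] --> x.
Proof.
apply/cvgrPdist_le => e e0; near=> k.
have k0 : (0 : R) < k.+1%:R by rewrite ltr0n.
have -> : x - (Num.floor (k.+1%:R * x))%:~R / k.+1%:R =
    (k.+1%:R * x - (Num.floor (k.+1%:R * x))%:~R) / k.+1%:R.
  by rewrite mulrBl mulrAC divff ?mul1r// gt_eqF.
rewrite ger0_norm; last by rewrite divr_ge0 ?subr_ge0 ?floor_le// ltW.
apply: (@le_trans _ _ k.+1%:R^-1).
  rewrite ler_pdivrMr// mulVf ?gt_eqF// lerBlDl -intrD1.
  by rewrite ltW// floorD1_gt.
rewrite ltW//; near: k; exact: (near_infty_natSinv_lt (PosNum e0)).
Unshelve. all: by end_near. Qed.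

(* Continuous functions are limits of their values at the grid points
   [floor (k x_i) / k], and those take countably many values. *)
Lemma measurable_continuous_row (R : realType) n (g : 'rV[R]_n -> R) :
  continuous g -> measurable_fun setT (fun z => g (row_of_tuple z)).
Proof.
move=> cg.
pose v k (z : n.-tuple (measurableTypeR R)) : {ffun 'I_n -> int} :=
  [ffun i => Num.floor (k.+1%:R * (tnth z i : R))].
pose q k (a : {ffun 'I_n -> int}) : 'rV[R]_n := \row_i ((a i)%:~R / k.+1%:R).
apply: (@measurable_fun_cvg _ _ _ _ (fun k z => g (q k (v k z)))) => [k|z _]; last first.
  apply: continuous_cvg; first exact: cg.
  apply: cvg_rowP => i; rewrite /q mxE.
  under eq_cvg do rewrite mxE ffunE.
  exact: floor_scaled_cvg.
move=> _ B mB; rewrite setTI.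
have -> : (fun z => g (q k (v k z))) @^-1` B =
    \bigcup_(a : {ffun 'I_n -> int}) (if g (q k a) \in B then v k @^-1` [set a] else set0).
  apply/seteqP; split => z /=.
    by move=> Bz; exists (v k z) => //; rewrite ifT//; exact/mem_set.
  by move=> [a _]; case: ifPn => // /set_mem Ba /= ->.
apply: countable_bigcupT_measurable => [|a]; first exact: countableP.
case: ifPn => // _.
have -> : v k @^-1` [set a] = \bigcap_(i in [set: 'I_n])
    ((fun z : n.-tuple (measurableTypeR R) => tnth z i) @^-1`
     ([set x : R | (a i)%:~R <= k.+1%:R * x] `&` [set x | k.+1%:R * x < (a i + 1)%:~R])).
  apply/seteqP; split => [z /= <- i _ /=|z /= H].
    by rewrite /v ffunE; split; [exact: floor_le|exact: floorD1_gt].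
  apply/ffunP => i; rewrite ffunE; have [/= H1 H2] := H i I.
  by apply/floor_def; rewrite H1 H2.
apply: fin_bigcap_measurable => // i _.
rewrite -[X in measurable X]setTI; apply: measurable_tnth => //.
have mk : measurable_fun setT (fun x : R => k.+1%:R * x) by exact: measurable_funM.
apply: measurableI.
- rewrite -[X in measurable X]setTI.
  rewrite [X in _ `&` X](_ : _ = (fun x : R => k.+1%:R * x) @^-1` `[(a i)%:~R, +oo[).
    by apply: mk => //; exact: measurable_itv.
  by apply/seteqP; split => x /=; rewrite in_itv/= andbT.
- rewrite -[X in measurable X]setTI.
  rewrite [X in _ `&` X](_ : _ = (fun x : R => k.+1%:R * x) @^-1` `]-oo, (a i + 1)%:~R[).
    by apply: mk => //; exact: measurable_itv.
  by apply/seteqP; split => x /=; rewrite in_itv/=.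
Qed.

Section translation.
Local Open Scope ereal_scope.
Context {R : realType}.

(** The image of Lebesgue measure under a translation gives half-open intervals their length, so
    uniqueness identifies it with Lebesgue measure. *)
Lemma ge0_integral_translate (f : R -> \bar R) (c : R) :
  measurable_fun setT f -> (forall x, 0 <= f x) ->
  \int[lebesgue_measure]_x f (x + c)%R = \int[lebesgue_measure]_x f x.
Proof.
move=> mf f0.
have mc : measurable_fun setT ((fun x => x + c)%R : _ -> measurableTypeR R).
  exact: measurable_funD.
have E A : measurable A -> pushforward lebesgue_measure
    ((fun x => x + c)%R : _ -> measurableTypeR R) A = lebesgue_measure A.
  move=> mA; apply/esym/lebesgue_measure_unique => //= _ [[a b]] _ <-.
  rewrite /pushforward.
  rewrite (_ : (fun x => x + c)%R @^-1` _ = `](a - c)%R, (b - c)%R]%classic).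
    by rewrite !lebesgue_measure_itv/= !lte_fin ltrD2r -!EFinB opprB addrA subrK.
  by apply/seteqP; split => x /=; rewrite !in_itv/= ltrBlDr lerBrDr.
transitivity (\int[pushforward lebesgue_measure
    ((fun x => x + c)%R : _ -> measurableTypeR R)]_x f x).
  by rewrite ge0_integral_pushforward.
by apply: eq_measure_integral => A mA _; exact: E.
Qed.

Definition tuple_add {n} (c z : n.-tuple (measurableTypeR R)) :
  n.-tuple (measurableTypeR R) := [tuple (tnth z i + tnth c i)%R | i < n].

Lemma measurable_tuple_add n (c : n.-tuple (measurableTypeR R)) : measurable_fun setT (tuple_add c).
Proof.
apply/measurable_fun_tnthP => i.
rewrite [X in measurable_fun _ X](_ : _ = fun z => (tnth z i + tnth c i)%R); last first.
  by apply/funext => z /=; rewrite tnth_mktuple.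
by apply: measurable_funD => //; exact: measurable_tnth.
Qed.

(** [lebesgue_step] is the pushforward of a product measure, so a change of variables and Tonelli
    split off the first coordinate; this drives the induction on the dimension. *)
Lemma ge0_integral_lebesgue_step n (mu : {sigma_finite_measure set (n.-tuple (measurableTypeR R)) -> \bar R})
  (f : n.+1.-tuple (measurableTypeR R) -> \bar R) :
  measurable_fun setT f -> (forall z, 0 <= f z) ->
  \int[lebesgue_step mu]_z f z = \int[lebesgue_measure]_x \int[mu]_w f (tuple_cons (x, w)).
Proof.
move=> mf f0.
transitivity (\int[pushforward (lebesgue_measure \x mu) (@tuple_cons R n)]_z f z); first by [].
rewrite ge0_integral_pushforward//; last exact: measurable_tuple_cons.
rewrite preimage_setT fubini_tonelli1//.
  by apply: measurableT_comp => //; exact: measurable_tuple_cons.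
by move=> z; exact: f0.
Qed.

(** Induction on [n]: the inner integral absorbs the shift of the tail, and one-dimensional
    invariance absorbs the shift of the head. *)
Lemma ge0_integral_tuple_translate n (f : n.-tuple (measurableTypeR R) -> \bar R) c :
  measurable_fun setT f -> (forall z, 0 <= f z) ->
  \int[lebesgue_tuple R n]_z f (tuple_add c z) = \int[lebesgue_tuple R n]_z f z.
Proof.
elim: n f c => [|n IH] f c mf f0.
  by apply: eq_integral => z _; rewrite [tuple_add c z]tuple0 [z]tuple0.
rewrite /= !ge0_integral_lebesgue_step//; last first.
  by apply: measurableT_comp => //; exact: measurable_tuple_add.
have mf2 : measurable_fun setT (f \o @tuple_cons R n).
  by apply: measurableT_comp => //; exact: measurable_tuple_cons.
transitivity (\int[lebesgue_measure]_x \int[lebesgue_tuple R n]_w f (tuple_cons ((x + thead c)%R, w))).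
  apply: eq_integral => x _.
  rewrite -(IH (fun w => f (tuple_cons ((x + thead c)%R, w))) [tuple of behead c])//; last first.
    exact: (measurableT_comp mf2 (pair1_measurable _)).
  apply: eq_integral => w _; congr (f _); apply: eq_from_tnth => i.
  rewrite tnth_mktuple; have [->|[j ->]] : i = ord0 \/ exists j, i = lift ord0 j.
  - by case: (unliftP ord0 i) => [j ->|->]; [right; exists j|left].
  - by rewrite /tuple_cons !tnth0.
  - rewrite /tuple_cons !tnthS tnth_mktuple tnth_behead; congr (_ + tnth c _)%R.
    by apply: val_inj; rewrite /= inordK ?ltnS.
rewrite (@ge0_integral_translate (fun x => \int[lebesgue_tuple R n]_w f (tuple_cons (x, w))))//.
  apply: (@measurable_fun_fubini_tonelli_F _ _ _ _ _ _ (f \o @tuple_cons R n)) => //; by move=> z; exact: f0.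
- by move=> x; exact: integral_ge0.
Qed.

End translation.

(** * Integration over space-time *)

Section space_time.
Context {R : realType} {d : nat}.
Notation Z := (measurableTypeR R * d.-tuple (measurableTypeR R))%type.
Notation M := (@lebesgue_measure R \x lebesgue_tuple R d)%E.

(** Positive and negative parts are translated separately, each by Tonelli at fixed time. *)
Lemma integral_translate (f : Z -> \bar R) (c : d.-tuple (measurableTypeR R)) :
  measurable_fun setT f ->
  (\int[M]_z f (z.1, tuple_add c z.2) = \int[M]_z f z)%E.
Proof.
move=> mf.
suff H g : measurable_fun setT g -> (forall z : Z, 0 <= g z)%E ->
    (\int[M]_z g (z.1, tuple_add c z.2) = \int[M]_z g z)%E.
  rewrite [LHS]integralE [RHS]integralE; congr (_ - _)%E.
  - rewrite -(H f^\+%E (measurable_funepos mf))//.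
    by apply: eq_integral => z _; rewrite !funeposE.
  - etransitivity; last exact: (H f^\-%E (measurable_funeneg mf)).
    by apply: eq_integral => z _; rewrite !funenegE.
move=> mg g0.
have mg' : measurable_fun setT (fun z : Z => g (z.1, tuple_add c z.2)).
  apply: measurableT_comp => //; apply/measurable_fun_pairP; split.
    exact: measurable_fst.
  rewrite (_ : snd \o _ = tuple_add c \o snd)//; apply: measurableT_comp.
    exact: measurable_tuple_add.
  exact: measurable_snd.
rewrite !fubini_tonelli1//; apply: eq_integral => x _; rewrite /fubini_F/=.
rewrite (@ge0_integral_tuple_translate _ _ (fun w => g (x, w)))//.
exact: (measurableT_comp mg (pair1_measurable _)).
Qed.

Lemma lebesgue_measure_segment_fin_num (a b : R) :
  lebesgue_measure `[a, b]%classic \is a fin_num.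
Proof. by rewrite lebesgue_measure_itv/=; case: ifP => // _; rewrite -EFinB. Qed.

(** A cube instead of a Euclidean ball: its measure factors along [tuple_cons], which makes
    finiteness an easy induction. *)
Definition box n (b : R) : set (n.-tuple (measurableTypeR R)) :=
  [set w | forall i, `|tnth w i : R| <= b].

Arguments box : clear implicits.

Lemma measurable_box n b : measurable (box n b).
Proof.
have -> : box n b = \bigcap_(i in [set: 'I_n])
    ((fun w : n.-tuple (measurableTypeR R) => tnth w i) @^-1` `[- b, b]%classic).
  apply/seteqP; split => [w H i _ /=|w H i]; first by rewrite in_itv/= -ler_norml.
  by have := H i I; rewrite /= in_itv/= -ler_norml.
apply: fin_bigcap_measurable => // i _.
by rewrite -[X in measurable X]setTI; apply: measurable_tnth.
Qed.

Lemma box_fin_measure n b : (lebesgue_tuple R n (box n b) < +oo)%E.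
Proof.
elim: n => [|n IH] /=; first by rewrite diracE ltry.
rewrite /lebesgue_step /pushforward.
have -> : @tuple_cons R n @^-1` box n.+1 b = `[-b, b]%classic `*` box n b.
  apply/seteqP; split => [[x w] /= H|[x w] [/= Hx Hw] i].
    split => /=.
      by have := H ord0; rewrite /tuple_cons tnth0 in_itv/= -ler_norml.
    by move=> i; have := H (lift ord0 i); rewrite /tuple_cons tnthS.
  case: (unliftP ord0 i) => [j ->|->].
    by rewrite /tuple_cons tnthS; exact: Hw.
  by rewrite /tuple_cons tnth0 ler_norml; move: Hx; rewrite in_itv.
rewrite product_measure1E//; last exact: measurable_box.
apply: lte_mul_pinfty => //.
exact: lebesgue_measure_segment_fin_num.
Qed.

Definition cylinder (b : R) : set Z := `[0, 1]%classic `*` box d b.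

Lemma cylinder_fin_measure b : (M (cylinder b) < +oo)%E.
Proof.
rewrite /cylinder product_measure1E//; last exact: measurable_box.
apply: lte_mul_pinfty => //; last exact: box_fin_measure.
exact: lebesgue_measure_segment_fin_num.
Qed.

Lemma integrable_cylinder (g : Z -> R) (b C : R) :
  measurable_fun setT g -> (forall z, `|g z| <= C) ->
  (forall z, g z != 0 -> cylinder b z) -> M.-integrable setT (EFin \o g).
Proof.
move=> mg gC gb.
have mc : measurable (cylinder b) by apply: measurableX => //; exact: measurable_box.
have -> : EFin \o g = (EFin \o g) \_ (cylinder b).
  apply/funext => z; rewrite patchE; case: ifPn => // /negP zb.
  by apply/eqP; apply: contrapT => /negP; rewrite /= eqe => /gb /mem_set.
apply: (integrable_mkcond _ mc).1.
apply: measurable_bounded_integrable => //.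
- exact: cylinder_fin_measure.
- exact: measurable_funS mg.
- exists C; split; first exact: num_real.
  by move=> x Cx z _ /=; rewrite (le_trans (gC z))// ltW.
Qed.

Lemma le_coord_enorm (x : 'rV[R]_d) i : `|x ord0 i| <= enorm x.
Proof.
rewrite -sqrtr_sqr; apply: ler_wsqrtr.
by rewrite (bigD1 i)//= lerDl; apply: sumr_ge0 => j _; exact: sqr_ge0.
Qed.

End space_time.

(** * Pairing with a kernel and mollification *)

(** Both sides have the same difference quotients. This turns derivatives along [v] into
    one-variable derivatives, the form required by the chain rule and by differentiation under the
    integral. *)
Lemma is_derive_lineE {R : realType} {d : nat} (f : 'rV[R]_d -> R) (x v : 'rV[R]_d) (h0 l : R) :
  is_derive h0 1 (fun h : R => f (x + h *: v)) l <-> is_derive (x + h0 *: v) v f l.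
Proof.
have E : (fun h : R => h^-1 *: (((fun s : R => f (x + s *: v)) \o shift h0) (h *: 1) - f (x + h0 *: v))) =
   (fun h : R => h^-1 *: ((f \o shift (x + h0 *: v)) (h *: v) - f (x + h0 *: v))).
  apply/funext => h /=; congr (_ *: (f _ - _)).
  by rewrite scalerDl [h *: 1]mulr1 [RHS]addrCA.
by split=> -[H1 H2]; split; rewrite /derivable /derive ?E// -?E.
Qed.

Section pairing.
Context {R : realType} {d : nat}.
Notation Z := (measurableTypeR R * d.-tuple (measurableTypeR R))%type.
Notation M := (@lebesgue_measure R \x lebesgue_tuple R d)%E.
Implicit Types (k : R -> 'rV[R]_d -> R) (f phi : 'rV[R]_d -> R) (x y a : 'rV[R]_d).

(** What all spatial derivatives of the mollifier share and what makes integrals against bounded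
    continuous functions converge. Neither sign nor differentiability is included, so one set of
    lemmas serves every order. *)
Record is_kernel k : Prop := IsKernel {
  kernel_measurable : measurable_fun setT (fun z : Z => k z.1 (row_of_tuple z.2));
  kernel_bounded : exists C, forall t y, `|k t y| <= C;
  kernel_support : forall t y, k t y != 0 -> 0 <= t <= 1 /\ enorm y <= 1 }.

Definition tuple_of_row x : d.-tuple (measurableTypeR R) := [tuple x ord0 i | i < d].

Lemma row_of_tuple_add (w : d.-tuple (measurableTypeR R)) a :
  row_of_tuple (tuple_add (tuple_of_row a) w) = row_of_tuple w + a.
Proof. by apply/rowP => i; rewrite !mxE !tnth_mktuple. Qed.

Lemma integrable_pairing_shift phi k (B : R) a :
  continuous phi -> (forall y, `|phi y| <= B) -> is_kernel k ->
  (M.-integrable setT (fun z : Z => (phi (row_of_tuple z.2) * k z.1 (row_of_tuple z.2 + a))%:E)).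
Proof.
move=> cphi phiB [mk [C kC] supp].
apply: (@integrable_cylinder _ _ (fun z : Z => phi (row_of_tuple z.2) * k z.1 (row_of_tuple z.2 + a)) (1 + enorm a) (B * C)).
- apply: measurable_funM.
    rewrite (_ : (fun z : Z => _) = (fun w : d.-tuple (measurableTypeR R) => phi (row_of_tuple w)) \o snd)//.
    apply: measurableT_comp; [exact: measurable_continuous_row|exact: measurable_snd].
  have m2 : measurable_fun setT (fun z : Z => (z.1, tuple_add (tuple_of_row a) z.2)).
    apply/measurable_fun_pairP; split; first exact: measurable_fst.
    rewrite (_ : snd \o _ = tuple_add (tuple_of_row a) \o snd)//; apply: measurableT_comp.
      exact: measurable_tuple_add.
    exact: measurable_snd.
  rewrite [X in measurable_fun _ X](_ : _ = (fun z : Z => k z.1 (row_of_tuple z.2)) \o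
     (fun z : Z => (z.1, tuple_add (tuple_of_row a) z.2))); last first.
    by apply/funext => z /=; rewrite row_of_tuple_add.
  exact: (measurableT_comp mk m2).
- by move=> z; rewrite normrM ler_pM.
- move=> z; rewrite mulf_eq0 negb_or => /andP[_ /supp[t01 ya]].
  split=> /=; first by rewrite in_itv.
  move=> i; have := le_coord_enorm (row_of_tuple z.2 + a) i; rewrite !mxE.
  have := le_coord_enorm a i => aE H.
  rewrite -[X in `|X|](addrK (a ord0 i)) (le_trans (ler_normB _ _))//.
  by rewrite lerD// (le_trans H).
Qed.

(** [phi] depends on space only, so the time variable is simply integrated out. *)
Definition pairing phi k : R := \int[M]_z (phi (row_of_tuple z.2) * k z.1 (row_of_tuple z.2)).

Definition mass k : R := \int[M]_z `|k z.1 (row_of_tuple z.2)|.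

Lemma integrable_pairing phi k (B : R) :
  continuous phi -> (forall y, `|phi y| <= B) -> is_kernel k ->
  (M.-integrable setT (EFin \o (fun z : Z => phi (row_of_tuple z.2) * k z.1 (row_of_tuple z.2)))).
Proof.
move=> cphi phiB kk; have := integrable_pairing_shift 0 cphi phiB kk.
by under eq_fun do rewrite addr0.
Qed.

Lemma integrable_kernel k : is_kernel k ->
  M.-integrable setT (EFin \o (fun z : Z => k z.1 (row_of_tuple z.2))).
Proof.
move=> kk; have := @integrable_pairing (cst 1) k 1 (@cst_continuous _ _ _) _ kk.
rewrite /comp /=; under eq_fun do rewrite mul1r; apply => _.
by rewrite normr1.
Qed.

Lemma pairingB phi psi k (B : R) :
  continuous phi -> continuous psi -> (forall y, `|phi y| <= B) -> (forall y, `|psi y| <= B) ->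
  is_kernel k -> pairing (phi \- psi) k = pairing phi k - pairing psi k.
Proof.
move=> cphi cpsi phiB psiB kk; rewrite /pairing -RintegralB//; last 2 first.
- exact: integrable_pairing phiB kk.
- exact: integrable_pairing psiB kk.
by apply: eq_Rintegral => z _; rewrite mulrBl.
Qed.

(** [A] is the sharp bound and concerns only the unit ball, which contains the spatial support of
    the kernel; [B] is global and only secures integrability. *)
Lemma le_norm_pairing phi k (A B : R) :
  continuous phi -> (forall y, `|phi y| <= B) -> is_kernel k ->
  (forall y, enorm y <= 1 -> `|phi y| <= A) -> `|pairing phi k| <= A * mass k.
Proof.
move=> cphi phiB kk phiA; have ik := integrable_kernel kk.
have ip := integrable_pairing cphi phiB kk.
rewrite (le_trans (le_normr_Rintegral _ ip))// -RintegralZl//; last first.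
  exact: (integrable_norm ik).
apply: le_Rintegral => //.
- exact: (integrable_norm ip).
- have ink := integrable_norm ik.
  exact: (integrableZl measurableT A ink).
- move=> z _; rewrite normrM.
  have [->|/(kernel_support kk)[_ /phiA H]] := eqVneq (k z.1 (row_of_tuple z.2)) 0.
    by rewrite normr0 !mulr0.
  by rewrite ler_wpM2r.
Qed.

(** Convolution of [f] with the time integral of the kernel at scale [delta], written in the
    rescaled variable so that no factor [delta^-d] appears. *)
Definition mollify (delta : R) f k x : R := pairing (fun y => f (x - delta *: y)) k.

Lemma continuous_affine_comp f : continuous f -> forall x (delta : R),
  continuous (fun y => f (x - delta *: y)).
Proof.
move=> cf x delta y; apply: continuous_comp; last exact: cf.
apply: continuousB; first exact: cst_continuous.
by apply: continuousZr; exact: cvg_id.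
Qed.

Lemma mollify_shift (delta : R) f k (B : R) x a :
  continuous f -> (forall y, `|f y| <= B) -> is_kernel k ->
  mollify delta f k (x + delta *: a) =
  \int[M]_z (f (x - delta *: row_of_tuple z.2) * k z.1 (row_of_tuple z.2 + a)).
Proof.
move=> cf fB kk; rewrite /mollify /pairing /Rintegral; congr fine.
rewrite -(@integral_translate _ _ _ (tuple_of_row a)); last first.
  have := integrable_pairing (@continuous_affine_comp f cf (x + delta *: a) delta) (fun y => fB _) kk.
  by move=> /integrableP[].
apply: eq_integral => z _; rewrite /= row_of_tuple_add.
by rewrite scalerDr opprD addrACA subrr addr0.
Qed.

(* After the change of variables [w + a], the increment falls on the kernel, so
   that [f] need not be differentiable. *)
Lemma is_derive_mollify (delta : R) f k k' (B : R) x v :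
  0 < delta -> continuous f -> (forall y, `|f y| <= B) -> is_kernel k -> is_kernel k' ->
  (forall t y, is_derive y v (k t) (k' t y)) ->
  is_derive x v (mollify delta f k) (delta^-1 * mollify delta f k' x).
Proof.
move=> d0 cf fB kk kk' dk.
have dn0 : delta != 0 by rewrite gt_eqF.
have B0 : 0 <= B by rewrite (le_trans _ (fB 0)).
pose F (h : R) (z : Z) := f (x - delta *: row_of_tuple z.2) * k z.1 (row_of_tuple z.2 + h *: v).
have iF h : M.-integrable setT (EFin \o F h).
  exact: integrable_pairing_shift (@continuous_affine_comp f cf x delta) (fun y => fB _) kk.
have dF h z : is_derive h (1 : R) (F ^~ z)
    (f (x - delta *: row_of_tuple z.2) * k' z.1 (row_of_tuple z.2 + h *: v)).
  have /is_derive_lineE H := dk z.1 (row_of_tuple z.2 + h *: v).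
  have := @is_deriveZ _ _ _ (fun s : R => k z.1 (row_of_tuple z.2 + s *: v))
    (f (x - delta *: row_of_tuple z.2)) h 1 _ H.
  exact.
have [C kC] := kernel_bounded kk'.
have C0 : 0 <= C by rewrite (le_trans _ (kC 0 0)).
(* Dominating function: for [|h| < 1] the shifted kernel [k'] stays supported in the cylinder of
   radius [1 + enorm v], which has finite measure. *)
pose G (z : Z) := B * C * \1_(cylinder (1 + enorm v)) z.
have mc : measurable (cylinder (d := d) (1 + enorm v)) by apply: measurableX => //; exact: measurable_box.
have iG : M.-integrable setT (EFin \o G).
  apply: (@integrable_cylinder _ _ G (1 + enorm v) (B * C)).
  - by apply: measurable_funM => //; exact: measurable_indic.
  - move=> z; rewrite /G normrM ger0_norm ?mulr_ge0// ler_piMr ?mulr_ge0//.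
    by rewrite indicE; case: (z \in _); rewrite ?normr1 ?normr0.
  - move=> z; rewrite /G mulf_eq0 negb_or indicE => /andP[_].
    by case: (boolP (z \in _)) => [/set_mem//|]; rewrite eqxx.
have G0 z : 0 <= G z by rewrite /G !mulr_ge0.
have dFG (h : R) z : `]-1, 1[%classic h -> setT z -> `|partial1of2 F h z| <= G z.
  rewrite /= in_itv/= => h1 _; rewrite partial1of2E (@derive_val _ _ _ _ _ _ _ (dF h z)).
  rewrite normrM; have [->|n0] := eqVneq (k' z.1 (row_of_tuple z.2 + h *: v)) 0.
    by rewrite normr0 mulr0.
  rewrite /G indicE mem_set ?mulr1 ?ler_pM//.
  have [t01 yv] := kernel_support kk' n0.
  split=> /=; first by rewrite in_itv.
  move=> i; have H := le_coord_enorm (row_of_tuple z.2 + h *: v) i; rewrite !mxE in H.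
  have Hv := le_coord_enorm v i.
  rewrite -[X in `|X|](addrK (h * v ord0 i)) (le_trans (ler_normB _ _))//.
  rewrite lerD// ?(le_trans H)// normrM (le_trans _ Hv)// ler_piMl//.
  by rewrite ler_norml; case/andP: h1 => ? ?; rewrite !ltW.
have I0 : `]-1, 1[%classic (0 : R) by rewrite /= in_itv/= ltrN10 ltr01.
have derF (h : R) z : `]-1, 1[%classic h -> setT z -> derivable (F ^~ z) h 1.
  by move=> _ _; case: (dF h z).
have dPhi : is_derive (0 : R) 1 (fun h => \int[M]_z F h z) (mollify delta f k' x).
  split.
    exact: (derivable_under_integral measurableT I0 (fun h _ => iF h) derF G0 iG dFG).
  rewrite -derive1E (differentiation_under_integral measurableT I0 (fun h _ => iF h) derF G0 iG dFG).
  apply: eq_Rintegral => z _; rewrite partial1of2E (@derive_val _ _ _ _ _ _ _ (dF 0 z)).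
  by rewrite scale0r addr0.
rewrite -[x in is_derive x](addr0 x) -[in is_derive _](scale0r v).
apply/is_derive_lineE.
(* Moving [x] by [h *: v] shifts the kernel by [(delta^-1 * h) *: v]; the chain rule then yields the
   factor [delta^-1]. *)
have -> : (fun h : R => mollify delta f k (x + h *: v)) =
    (fun h => \int[M]_z F h z) \o (fun h : R => delta^-1 *: h).
  apply/funext => h /=.
  rewrite -[in LHS](mulVKf dn0 h) -scalerA (mollify_shift _ _ _ cf fB kk).
  by [].
have dlin : is_derive (0 : R) 1 (fun h : R => delta^-1 *: h) (delta^-1 *: 1).
  exact: is_deriveZ.
have dPhi' : is_derive (delta^-1 *: (0 : R)) 1 (fun h => \int[M]_z F h z) (mollify delta f k' x).
  by rewrite scaler0.
have := is_derive1_comp dPhi' dlin.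
by rewrite [_ *: 1]mulr1 mulrC.
Qed.

End pairing.

(** * The Euclidean norm *)

Section euclidean_norm.
Context {R : realType} {d : nat}.
Implicit Types (f : 'rV[R]_d -> R) (x y : 'rV[R]_d).

Lemma enorm_ge0 x : 0 <= enorm x. Proof. exact: sqrtr_ge0. Qed.

Lemma enormZ (c : R) x : enorm (c *: x) = `|c| * enorm x.
Proof.
rewrite /enorm (eq_bigr (fun i => c ^+ 2 * x ord0 i ^+ 2)) => [|i _].
  by rewrite -mulr_sumr sqrtrM ?sqr_ge0// sqrtr_sqr.
by rewrite mxE exprMn.
Qed.

Lemma enorm_delta i : enorm (delta_mx ord0 i : 'rV[R]_d) = 1.
Proof.
rewrite /enorm (bigD1 i)//= big1 => [|j ji]; last by rewrite mxE (negbTE ji) andbF expr0n.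
by rewrite mxE !eqxx addr0 expr1n sqrtr1.
Qed.

Lemma continuous_enorm : continuous (@enorm R d).
Proof.
move=> x; apply: (@continuous_comp _ _ _ (fun x : 'rV[R]_d => \sum_(i < d) x ord0 i ^+ 2) Num.sqrt).
  apply: (@cvg_big _ _ (fun a b : R => a + b)) => [|| i _]; [exact: add_continuous|exact: nbhs_filter|].
  apply: (@continuous_comp _ _ _ (fun x : 'rV[R]_d => x ord0 i) (fun a : R => a ^+ 2)).
    exact: coord_continuous.
  exact: exprn_continuous.
exact: sqrt_continuous.
Qed.

Definition lipschitz_enorm (l : R) f := forall x y, `|f x - f y| <= l * enorm (x - y).

Lemma lipschitz_enorm_continuous l f : lipschitz_enorm l f -> continuous f.
Proof.
move=> fl x; have xF := nbhs_filter x; apply/cvgrPdist_le => /= e e0.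
have c0 : (l * enorm (x - y)) @[y --> x] --> l * enorm (x - x).
  apply: cvgMr; apply: (@continuous_comp _ _ _ (fun y => x - y)); last exact: continuous_enorm.
  by apply: cvgB; [exact: cvg_cst|exact: cvg_id].
have e00 : enorm (x - x) = 0 by rewrite subrr -(scale0r x) enormZ normr0 mul0r.
rewrite e00 mulr0 in c0.
near=> y; rewrite (le_trans (fl _ _))//.
rewrite (le_trans (ler_norm _))// -[leLHS]normrN -[X in `|X|]sub0r.
by near: y; move/cvgrPdist_le : c0; exact.
Unshelve. all: by end_near. Qed.

(** Every difference quotient is bounded by [l] because the basis vector has norm 1. Used for the
    mollification and again for its first derivatives. *)
Lemma lipschitz_pderive l f x i (df : R) : lipschitz_enorm l f ->
  is_derive x (delta_mx ord0 i) f df -> `|df| <= l.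
Proof.
move=> fl [/cvg_ex[/= a fa] <-].
have -> : 'D_(delta_mx ord0 i) f x = a by apply/cvg_lim.
have na : `|h^-1 *: (f (h *: delta_mx ord0 i + x) - f x)| @[h --> 0^'] --> `|a|.
  by apply: cvg_norm.
apply: (cvgr_to_le na).
near=> h; rewrite normrZ normfV.
have h0 : h != 0 by near: h; exact: nbhs_dnbhs_neq.
rewrite ler_pdivrMl ?normr_gt0// (le_trans (fl _ _))// addrK enormZ enorm_delta mulr1.
by rewrite mulrC.
Unshelve. all: by end_near. Qed.

End euclidean_norm.

(** * The derivatives of the mollifier as kernels *)

Section eta_kernel.
Context {R : realType} {d : nat}.
Notation Z := (measurableTypeR R * d.-tuple (measurableTypeR R))%type.
Notation M := (@lebesgue_measure R \x lebesgue_tuple R d)%E.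
Implicit Types (s : seq 'I_d) (i : 'I_d) (x y : 'rV[R]_d).
Variable eta : R -> 'rV[R]_d -> R.
Hypothesis heta : is_mollifier eta.

(* The extension by 0 to negative times replaces integrals over [half_space] by
   integrals over the whole space. *)
Definition eta_kernel s (t : R) y : R :=
  if 0 <= t then pderives s (eta t) y else 0.

Definition space_time_row (t : R) y : 'rV[R]_(1 + d) := row_mx (t%:M : 'rV[R]_1) y.

Lemma space_time_row_shift t y (h : R) i :
  space_time_row t (y + h *: delta_mx ord0 i) =
  space_time_row t y + h *: delta_mx ord0 (rshift 1 i).
Proof.
apply/rowP => j; rewrite !mxE; case: splitP => l jl; rewrite !mxE.
  have -> : (j == rshift 1 i) = false.
    by rewrite -(inj_eq val_inj) /= jl [l]ord1 add1n.
  by rewrite andbF mulr0 addr0 ord1.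
have -> : (j == rshift 1 i) = (l == i).
  by rewrite -(inj_eq val_inj) /= jl eqn_add2l.
by [].
Qed.

Lemma is_derive_space_time_row (G : 'rV[R]_(1 + d) -> R) t y i (l : R) :
  is_derive (space_time_row t y) (delta_mx ord0 (rshift 1 i)) G l ->
  is_derive y (delta_mx ord0 i) (fun y => G (space_time_row t y)) l.
Proof.
move=> HG.
rewrite -[y in is_derive y](addr0 y) -[in is_derive _](scale0r (delta_mx ord0 i)).
apply/is_derive_lineE.
rewrite (_ : (fun h : R => _) = fun h => G (space_time_row t y + h *: delta_mx ord0 (rshift 1 i))).
  by apply/is_derive_lineE; rewrite scale0r addr0.
by apply/funext => h; rewrite space_time_row_shift.
Qed.

(** Smoothness of [eta] is given through an extension to all of space-time; the spatial derivatives
    of [eta] are the derivatives of this extension in the last [d] coordinates, hence the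
    [rshift]. *)
Lemma eta_kernel_ext : exists2 g : 'rV[R]_(1 + d) -> R, smooth g &
  forall s t y, 0 <= t -> eta_kernel s t y = pderives (map (@rshift 1 d) s) g (space_time_row t y).
Proof.
have [[g gs gE] _ _ _] := heta; exists g => // s t y t0; rewrite /eta_kernel t0.
elim: s y => [|i s IH] y; first by rewrite /= gE.
rewrite /= /pderive.
have -> : pderives s (eta t) = fun y => pderives (map (@rshift 1 d) s) g (space_time_row t y).
  by apply/funext => z; exact: IH.
apply: derive_val; apply: is_derive_space_time_row.
by split => //; exact: (gs _).2.
Qed.

Lemma is_derive_eta_kernel s i t y :
  is_derive y (delta_mx ord0 i) (eta_kernel s t) (eta_kernel (i :: s) t y).
Proof.
have [g gs gE] := eta_kernel_ext.
have [t0|t0] := leP 0 t.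
  rewrite gE//= (_ : eta_kernel s t = fun y => pderives (map (@rshift 1 d) s) g (space_time_row t y)).
    by apply: is_derive_space_time_row; split => //; exact: (gs _).2.
  by apply/funext => z; rewrite gE.
have E s' : eta_kernel s' t = cst 0.
  by apply/funext => z; rewrite /eta_kernel leNgt t0.
by rewrite !E; exact: is_derive_cst.
Qed.

(** Differentiation does not enlarge the support: at an excluded time the function of [y] is zero
    everywhere, and outside the closed unit ball, an open set, it is zero near each point. *)
Lemma eta_kernel_support s t y : eta_kernel s t y != 0 -> 0 <= t <= 1 /\ enorm y <= 1.
Proof.
have [t0|t0] := leP 0 t; last by rewrite /eta_kernel leNgt t0 eqxx.
apply: contraPP => /not_andP H.
apply/negP; rewrite negbK; apply/eqP; elim: s y H => [|i s IH] y H.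
  rewrite /eta_kernel t0/=; apply/eqP; apply: contrapT => /negP /(mol_support heta t0)[t1 y1].
  by case: H => //; rewrite t0.
have [_ <-] := is_derive_eta_kernel s i t y.
rewrite -(@near_eq_derive _ _ _ (cst 0) (eta_kernel s t) y) ?derive_cst//.
have yF := nbhs_filter y.
case: H => [t1|/negP]; first by apply: (filterS _ (@filterT _ (nbhs y) yF)) => z _; rewrite IH//; left.
rewrite -ltNge => y1.
have := @continuous_enorm R d y => /cvgr_gt/(_ _ y1).
by apply: filterS => z z1; rewrite IH//; right; apply/negP; rewrite -ltNge.
Qed.

Lemma eta_kernel_is_kernel s : is_kernel (eta_kernel s).
Proof.
have [g gs gE] := eta_kernel_ext.
split; last exact: eta_kernel_support.
- pose G := pderives (map (@rshift 1 d) s) g.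
  rewrite (_ : (fun z : Z => _) = fun z : Z => if 0 <= (z.1 : R) then
      ((fun w : d.+1.-tuple (measurableTypeR R) => G (row_of_tuple w)) \o @tuple_cons R d) z
      else 0); last first.
    apply/funext => z /=; have [t0|t0] := leP 0 (z.1 : R); last first.
      by rewrite /eta_kernel leNgt t0.
    rewrite gE//; congr G; apply/rowP => j; rewrite !mxE /tuple_cons.
    case: splitP => l jl.
      rewrite mxE [l]ord1 mulr1n; have -> : j = ord0.
        by apply: val_inj; rewrite /= jl [l]ord1.
      by rewrite tnth0.
    rewrite mxE; have -> : j = lift ord0 l by apply: val_inj.
    by rewrite tnthS.
  apply: measurable_fun_ifT.
  + apply: (@measurable_fun_ler _ _ _ _ (cst 0) (fun z : Z => z.1 : R)) => //.
    exact: measurable_fst.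
  + apply: measurableT_comp; last exact: measurable_tuple_cons.
    exact: (measurable_continuous_row (gs _).1).
  + exact: measurable_cst.
(* The cube [[-1, 1]^(1 + d)] contains the space-time support; a derivative of [g] is continuous,
   hence bounded there. *)
- have cK : compact [set v : 'rV[R]_(1 + d) | forall j, `[-1, 1]%classic (v ord0 j)].
    have := @rV_compact R (1 + d) (fun=> `[-1, 1]%classic) (fun _ => @segment_compact R (-1) 1).
    exact.
  have : bounded_set (pderives (map (@rshift 1 d) s) g @`
      [set v : 'rV[R]_(1 + d) | forall j, `[-1, 1]%classic (v ord0 j)]).
    apply: compact_bounded; apply: continuous_compact.
      by apply: continuous_subspaceT; exact: (gs _).1.
    exact: cK.
  move=> [C [_ HC]]; exists (`|C| + 1) => t y.
  have [->|n0] := eqVneq (eta_kernel s t y) 0; first by rewrite normr0 addr_ge0.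
  have [/andP[t0 t1] y1] := eta_kernel_support n0.
  rewrite gE//; apply: HC; first by rewrite ltr_pwDr// ler_norm.
  exists (space_time_row t y) => //= j; rewrite in_itv/= -ler_norml mxE.
  case: splitP => l jl; first by rewrite mxE [l]ord1 eqxx mulr1n ger0_norm.
  by rewrite (le_trans (le_coord_enorm _ _)).
Qed.

End eta_kernel.

(** * The constant [b01] *)

Section mollification.
Context {R : realType} {d : nat}.
Notation Z := (measurableTypeR R * d.-tuple (measurableTypeR R))%type.
Notation M := (@lebesgue_measure R \x lebesgue_tuple R d)%E.
Implicit Types (s : seq 'I_d) (i : 'I_d) (x y : 'rV[R]_d) (f : 'rV[R]_d -> R) (k : R -> 'rV[R]_d -> R).

(** The increment stays on [f], so its Lipschitz constant is multiplied by the [L^1] norm of the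
    kernel. With a first derivative of [eta] as kernel this controls second derivatives while
    differentiating [eta] only once. *)
Lemma lipschitz_mollify (delta r B : R) f k : lipschitz_enorm r f -> (forall y, `|f y| <= B) ->
  is_kernel k -> lipschitz_enorm (r * mass k) (mollify delta f k).
Proof.
move=> fr fB kk x y; have cf := lipschitz_enorm_continuous fr.
have cx := @continuous_affine_comp _ _ f cf x delta.
have cy := @continuous_affine_comp _ _ f cf y delta.
rewrite -(pairingB cx cy (fun _ => fB _) (fun _ => fB _) kk) mulrAC.
apply: (@le_norm_pairing _ _ _ _ _ (B + B)) => //.
- by move=> z; apply: continuousB; [exact: cx|exact: cy].
- by move=> z; rewrite (le_trans (ler_normB _ _))// lerD.
- by move=> z _; rewrite (le_trans (fr _ _))// opprB addrA subrK.
Qed.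

Variable eta : R -> 'rV[R]_d -> R.
Hypothesis heta : is_mollifier eta.
Let K := eta_kernel eta.
Let kerK s : is_kernel (K s) := eta_kernel_is_kernel heta s.

Lemma integral_half_space (F G : Z -> \bar R) :
  (forall z : Z, (0 : R) <= z.1 -> F z = G z) -> (forall z : Z, (z.1 : R) < 0 -> G z = 0%E) ->
  (\int[M]_(z in @half_space R d) F z = \int[M]_z G z)%E.
Proof.
move=> FG G0; rewrite integral_mkcond; apply: eq_integral => z _; rewrite patchE.
case: ifPn => [/set_mem z0|z0]; first exact: FG.
by rewrite G0// ltNge; apply/negP => z1; move/negP: z0; apply; exact/mem_set.
Qed.

Lemma Rintegral_eta_kernel : \int[M]_z K [::] z.1 (row_of_tuple z.2) = 1.
Proof.
rewrite /Rintegral -(@integral_half_space (fun z => (eta z.1 (row_of_tuple z.2))%:E)).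
- by rewrite (mol_integral heta).
- by move=> z z0; rewrite /K /eta_kernel z0.
- by move=> z z0; rewrite /K /eta_kernel leNgt z0.
Qed.

Lemma mass_eta_kernel0 : mass (K [::]) = 1.
Proof.
rewrite -Rintegral_eta_kernel; apply: eq_Rintegral => z _.
rewrite ger0_norm// /K /eta_kernel; case: ifP => // z0; exact: (mol_ge0 heta).
Qed.

(* [Dmulti a f] is [pderives (multi_word a) f]. *)
Definition multi_word l (a : {ffun 'I_d -> 'I_l.+1}) : seq 'I_d :=
  flatten [seq nseq (a i) i | i <- enum 'I_d].

Lemma space_deriv_L1E (a : {ffun 'I_d -> 'I_2}) :
  space_deriv_L1 eta a = (mass (K (multi_word a)))%:E.
Proof.
rewrite /mass /Rintegral fineK; last first.
  exact: (integrable_fin_num measurableT (integrable_norm (integrable_kernel (kerK _)))).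
apply: integral_half_space => z z0; first by rewrite /K /eta_kernel z0.
by rewrite /K /eta_kernel leNgt z0 normr0.
Qed.

Lemma mass_le_b01 i : mass (K [:: i]) <= b01 eta.
Proof.
(* The multi-index of order one at [i], one competitor in the maximum that defines [b01]. *)
pose a : {ffun 'I_d -> 'I_2} := [ffun j => inord (j == i)].
have aE j : a j = (j == i) :> nat by rewrite ffunE inordK//; case: (j == i).
have wE : multi_word a = [:: i].
  rewrite -(@filter_pred1_uniq _ (enum 'I_d) i (enum_uniq _) (mem_enum _ i)).
  rewrite /multi_word; elim: (enum 'I_d) => //= j s ->; rewrite aE.
  by case: (j == i).
have am : multi_index a.
  rewrite /multi_index (bigD1 i)//= aE eqxx big1 ?addn0// => j /negbTE ji.
  by rewrite aE ji.
rewrite /b01; under eq_bigr do rewrite space_deriv_L1E.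
by rewrite EFin_bigmax/= -wE; apply: (@le_bigmax_cond _ _ _ _ a).
Qed.

(* The mollification of the truncated first coordinate has slope 1 at the
   origin, and this slope is the integral of a function bounded by 1 on the unit
   ball against the first derivative of the kernel. *)
Lemma b01_ge1 : (0 < d)%N -> 1 <= b01 eta.
Proof.
move=> d0; pose i := Ordinal d0; apply: le_trans (mass_le_b01 i).
(* Truncation makes the coordinate bounded, as the pairing requires; level 2 is invisible at [h - z]
   with [|h| <= 1] and [|z| <= 1]. *)
pose f (x : 'rV[R]_d) : R := Num.max (- 2) (Num.min 2 (x ord0 i)).
have fB y : `|f y| <= 2.
  rewrite ler_norml /f le_max lexx/= ge_max ge_min lexx/= andbT.
  by rewrite (@le_trans _ _ 0)// oppr_le0.
have fE y : `|y ord0 i| <= 2 -> f y = y ord0 i.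
  rewrite ler_norml => /andP[y1 y2].
  by rewrite /f min_r// max_r.
have f_lip : lipschitz_enorm 1 f.
  move=> x y; rewrite mul1r; have := le_coord_enorm (x - y) i; rewrite !mxE.
  apply: le_trans; rewrite /f.
  have H (a b : R) : Num.max (- 2) (Num.min 2 a) - Num.max (- 2) (Num.min 2 b) <= `|a - b|.
    have := ler_norm (a - b); have := normr_ge0 (a - b).
    rewrite /Num.max /Num.min.
    by case: (ltP 2 a) => ?; case: (ltP 2 b) => ?; repeat case: ltP => ?; lra.
  by rewrite ler_norml lerNl opprB H distrC H.
have cf := lipschitz_enorm_continuous f_lip.
have D := is_derive_mollify 0 ltr01 cf fB (kerK [::]) (kerK [:: i])
   (fun t y => is_derive_eta_kernel heta [::] i t y).
pose phi := mollify 1 f (K [::]).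
have lin (h : R) : `|h| <= 1 -> phi (0 + h *: delta_mx ord0 i) = phi 0 + h.
  move=> h1; apply/eqP; rewrite [phi 0 + h]addrC -subr_eq.
  have cx x := @continuous_affine_comp _ _ f cf x 1.
  rewrite /phi /mollify -(pairingB (cx _) (cx _) (fun _ => fB _) (fun _ => fB _) (kerK _)).
  apply/eqP; rewrite -[RHS]mulr1 -[in RHS]Rintegral_eta_kernel -RintegralZl//; last first.
    exact: (integrable_kernel (kerK _)).
  apply: eq_Rintegral => z _.
  have [->|n0] := eqVneq (K [::] z.1 (row_of_tuple z.2)) 0; first by rewrite !mulr0.
  have [_ z1] := kernel_support (kerK _) n0.
  have zi := le_trans (le_coord_enorm _ i) z1.
  congr (_ * _); rewrite /= !scale1r !fE ?mxE ?add0r ?sub0r ?normrN ?eqxx ?mulr1.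
  - by rewrite addrC opprK addrC subrK.
  - by rewrite mxE in zi; rewrite (le_trans zi)// ler1n.
  - by rewrite mxE in zi; rewrite (le_trans (ler_normB _ _))// (le_trans (lerD h1 zi))// -[1 + 1]/(2%:R).
have D1 : is_derive (0 : 'rV[R]_d) (delta_mx ord0 i) phi 1.
  rewrite -[X in is_derive X](addr0 0) -[X in 0 + X](scale0r (delta_mx ord0 i)).
  apply/is_derive_lineE.
  apply: (@near_eq_is_derive _ _ _ (fun h => phi 0 + h)).
    by near=> h; rewrite lin//; near: h; exact: nbhs0_le.
  have := is_deriveD (is_derive_cst (phi 0) (0 : R) 1) (is_derive_id (0 : R) 1).
  by rewrite add0r.
(* The slope at the origin computed in two ways: directly, and with the derivative on the kernel. *)
have := @derive_val _ _ _ _ _ _ _ D; rewrite (@derive_val _ _ _ _ _ _ _ D1) invr1 mul1r => E1.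
rewrite -[leRHS]mul1r; apply: (@le_trans _ _ `|mollify 1 f (K [:: i]) 0|).
  by rewrite -E1 normr1.
apply: (le_norm_pairing _ (fun y => fB _) (kerK _)) => [|y y1].
  exact: @continuous_affine_comp _ _ f cf 0 1.
(* On the unit ball the truncated coordinate is bounded by 1, although its global bound is 2. *)
have yi := le_trans (le_coord_enorm _ i) y1.
rewrite /= scale1r sub0r fE !mxE normrN// (le_trans yi)//.
by rewrite ler1n.
Unshelve. all: by end_near. Qed.

End mollification.

(** * Bounds on mollifications *)

Lemma size_multi_word d l (a : {ffun 'I_d -> 'I_l.+1}) :
  size (multi_word a) = (\sum_i a i)%N.
Proof.
rewrite size_flatten /shape -map_comp sumnE big_map big_enum /=.
by apply: eq_bigr => i _; rewrite size_nseq.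
Qed.

Lemma count_multi_word d l (a : {ffun 'I_d -> 'I_l.+1}) i :
  count_mem i (multi_word a) = a i.
Proof.
rewrite count_flatten -map_comp sumnE big_map big_enum /= (bigD1 i)//=.
rewrite count_nseq /= eqxx mul1n big1 ?addn0// => j /negbTE ji.
by rewrite count_nseq /= ji.
Qed.

(** A multi-index is recovered from the letter counts of its word, so multi-indices inject into the
    words of length [l] over [d] letters. *)
Lemma card_multi_index d l : (0 < d)%N ->
  (#|[pred a : {ffun 'I_d -> 'I_l.+1} | multi_index a]| <= d ^ l)%N.
Proof.
move=> d0; pose i0 := Ordinal d0.
pose w (a : {ffun 'I_d -> 'I_l.+1}) : {ffun 'I_l -> 'I_d} := [ffun j : 'I_l => nth i0 (multi_word a) j].
rewrite -[X in (_ <= X ^ _)%N]card_ord -[X in (_ <= _ ^ X)%N]card_ord -card_ffun.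
apply: (leq_card_in w) => a b; rewrite !inE /multi_index => /eqP al /eqP bl wab.
have E : multi_word a = multi_word b.
  apply: (@eq_from_nth _ i0); first by rewrite !size_multi_word al bl.
  move=> j; rewrite size_multi_word al => jl.
  by have /ffunP/(_ (Ordinal jl)) := wab; rewrite !ffunE.
by apply/ffunP => i; apply: val_inj; rewrite /= -!count_multi_word E.
Qed.

Section sup_norms.
Context {R : realType} {d : nat}.
Implicit Types (f : 'rV[R]_d -> R).

Lemma sup_norm_leP f (c : R) : (sup_norm f <= c%:E)%E <-> forall x, `|f x| <= c.
Proof.
split=> [H x|H].
  by rewrite -lee_fin (le_trans _ H)//; apply: ereal_sup_ubound; exists x.
by apply: ge_ereal_sup => _ [x _ <-]; rewrite lee_fin.
Qed.

Lemma sup_norm_ge0 f : (0 <= sup_norm f)%E.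
Proof. by apply: (@le_trans _ _ `|f 0|%:E); [rewrite lee_fin|apply: ereal_sup_ubound; exists 0]. Qed.

(** There are at most [d^l] summands, each at most [c^2]; the resulting factor cancels the
    normalisation in the arguments of [rho1]. The bound also makes [Dnorm l f] finite, so [fine]
    does not fall back on its default 0. *)
Lemma fine_Dnorm_le l f (c : R) : (0 < d)%N -> 0 <= c ->
  (forall s x, size s = l -> `|pderives s f x| <= c) ->
  0 <= fine (Dnorm l f) <= Num.sqrt (d%:R ^+ l) * c.
Proof.
move=> d0 c0 fc.
have H : (Dnorm l f <= (Num.sqrt (d%:R ^+ l) * c)%:E)%E.
  apply/sup_norm_leP => x; rewrite ger0_norm ?sqrtr_ge0//.
  rewrite -[leRHS]ger0_norm ?mulr_ge0 ?sqrtr_ge0// -sqrtr_sqr ler_wsqrtr//.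
  rewrite exprMn sqr_sqrtr ?exprn_ge0//.
  apply: (@le_trans _ _ (\sum_(a : {ffun 'I_d -> 'I_l.+1} | multi_index a) c ^+ 2)).
    apply: ler_sum => a /eqP al; rewrite -(real_normK (num_real (Dmulti a f x))).
    by rewrite lerXn2r ?nnegrE// fc// size_multi_word.
  rewrite sumr_const -[leLHS]mulr_natl ler_wpM2r ?sqr_ge0// -natrX ler_nat.
  exact: card_multi_index.
have H0 : (0 <= Dnorm l f)%E by exact: sup_norm_ge0.
rewrite fine_ge0//= -lee_fin fineK//.
by rewrite ge0_fin_numE// (le_lt_trans H)// ltry.
Qed.

End sup_norms.

Section approximation.
Context {R : realType} {d : nat}.
Variables (eta : R -> 'rV[R]_d -> R) (heta : is_mollifier eta).
Variables (r B delta : R) (f : 'rV[R]_d -> R).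
Hypotheses (d0 : (0 < d)%N) (r0 : 0 <= r) (delta0 : 0 < delta).
Hypotheses (f_lip : lipschitz_enorm r f) (fB : forall y, `|f y| <= B).
Let K := eta_kernel eta.
Let kerK s : is_kernel (K s) := eta_kernel_is_kernel heta s.
Let cf : continuous f := lipschitz_enorm_continuous f_lip.
Let g := mollify delta f (K [::]).

Lemma is_derive_mollify_eta s i x :
  is_derive x (delta_mx ord0 i) (fun x => delta^-1 ^+ size s * mollify delta f (K s) x)
    (delta^-1 ^+ (size s).+1 * mollify delta f (K (i :: s)) x).
Proof.
have H := is_derive_mollify x delta0 cf fB (kerK s) (kerK (i :: s))
  (fun t y => is_derive_eta_kernel heta s i t y).
by have := is_deriveZ (delta^-1 ^+ size s) H; rewrite -[_ *: (_ * _)]/(_ * (_ * _)) mulrA -exprSr.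
Qed.

Lemma pderives_mollify s :
  pderives s g = fun x => delta^-1 ^+ size s * mollify delta f (K s) x.
Proof.
elim: s => [|i s IH]; first by apply/funext => x; rewrite expr0 mul1r.
apply/funext => x; rewrite /= IH /pderive; apply: derive_val.
exact: is_derive_mollify_eta.
Qed.

(** A crude bound with all derivatives on the kernel; it serves only to place the mollification in
    [Cb_smooth]. *)
Lemma norm_pderives_mollify s x : `|pderives s g x| <= delta^-1 ^+ size s * (B * mass (K s)).
Proof.
have dn : 0 <= delta^-1 ^+ size s by rewrite exprn_ge0// invr_ge0 ltW.
rewrite pderives_mollify normrM (ger0_norm dn); apply: ler_wpM2l => //.
apply: (le_norm_pairing _ (fun y => fB _) (kerK _)) => //; exact: @continuous_affine_comp _ _ f cf x delta.
Qed.

Lemma Cb_smooth_mollify : Cb_smooth g.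
Proof.
split=> s.
  split; last first.
    by move=> i x; rewrite pderives_mollify; case: (is_derive_mollify_eta s i x).
  rewrite pderives_mollify => x; apply: cvgMr.
    exact: nbhs_filter.
  exact: (lipschitz_enorm_continuous (lipschitz_mollify delta f_lip fB (kerK s))).
apply: le_lt_trans (ltry (delta^-1 ^+ size s * (B * mass (K s)))).
by apply/sup_norm_leP => x; exact: norm_pderives_mollify.
Qed.

(** The kernel has integral 1, so [f x] is itself a pairing, and only displacements of length at
    most [delta] enter. *)
Lemma mollify_close x : `|g x - f x| <= r * delta.
Proof.
have cx := @continuous_affine_comp _ _ f cf x delta.
have -> : f x = pairing (fun=> f x) (K [::]).
  rewrite /pairing RintegralZl//; last exact: (integrable_kernel (kerK _)).
  by rewrite Rintegral_eta_kernel// mulr1.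
rewrite -(pairingB cx (@cst_continuous _ _ _) (fun _ => fB _) (fun _ => fB _) (kerK _)).
rewrite -[leRHS]mulr1 -(mass_eta_kernel0 heta).
apply: (@le_norm_pairing _ _ _ _ _ (B + B)) => //.
- by move=> z; apply: continuousB; [exact: cx|exact: cst_continuous].
- by move=> z; rewrite (le_trans (ler_normB _ _))// lerD.
- move=> y y1; rewrite (le_trans (f_lip _ _))// addrAC subrr add0r -scaleNr enormZ.
  by rewrite normrN gtr0_norm// ler_wpM2l// ler_piMr// ltW.
Qed.

(** The unit mass of [eta] preserves the Lipschitz constant [r], and the square root of [d]
    cancels. *)
Lemma mollify_Dnorm1 : 0 <= (Num.sqrt d%:R)^-1 * fine (Dnorm 1 g) <= r.
Proof.
have /(fine_Dnorm_le d0 r0)/andP[H1 H2] : forall s x, size s = 1%N -> `|pderives s g x| <= r.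
  move=> [|i [|//]]// x _.
  have := is_derive_mollify_eta [::] i x; rewrite -[X in is_derive _ _ X]pderives_mollify => D.
  rewrite /= /pderive (@derive_val _ _ _ _ _ _ _ D).
  apply: lipschitz_pderive D; rewrite pderives_mollify/=.
  have := lipschitz_mollify delta f_lip fB (kerK [::]).
  by rewrite mass_eta_kernel0// mulr1 => H y z; rewrite !expr0 !mul1r.
have d1 : 0 < Num.sqrt (d%:R : R) by rewrite sqrtr_gt0 ltr0n.
by rewrite mulr_ge0 ?invr_ge0 ?sqrtr_ge0//= mulrC ler_pdivrMr// mulrC -[d%:R]expr1.
Qed.

Lemma mollify_Dnorm2 : 0 <= d%:R^-1 * fine (Dnorm 2 g) <= r * b01 eta / delta.
Proof.
have b0 : 0 <= b01 eta by rewrite (le_trans ler01)// b01_ge1.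
have C0 : 0 <= r * b01 eta / delta by rewrite divr_ge0 ?mulr_ge0// ltW.
have /(fine_Dnorm_le d0 C0)/andP[H1 H2] : forall s x, size s = 2%N ->
    `|pderives s g x| <= r * b01 eta / delta.
  move=> [|i [|j [|//]]]// x _.
  have := is_derive_mollify_eta [:: j] i x; rewrite -[X in is_derive _ _ X]pderives_mollify => D.
  rewrite /= /pderive (@derive_val _ _ _ _ _ _ _ D).
  (* The first derivative along [j] has [eta] differentiated once as its kernel and is Lipschitz
     with constant [r * b01 eta / delta]; this bounds its derivative along [i]. *)
  apply: lipschitz_pderive D; rewrite pderives_mollify/= => y z.
  have dn : 0 <= delta^-1 by rewrite invr_ge0 ltW.
  rewrite -mulrBr normrM expr1 (ger0_norm dn).
  rewrite [leRHS](_ : _ = delta^-1 * (r * b01 eta * enorm (y - z))); last first.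
    by rewrite mulrAC [LHS]mulrC.
  apply: ler_wpM2l => //.
  rewrite (le_trans (lipschitz_mollify _ f_lip fB (kerK _) _ _))// ler_wpM2r ?enorm_ge0//.
  by rewrite ler_wpM2l// mass_le_b01.
have d1 : 0 < (d%:R : R) by rewrite ltr0n.
rewrite mulr_ge0 ?invr_ge0 ?ler0n//= mulrC ler_pdivrMr// mulrC.
by rewrite sqrtr_sqr ger0_norm in H2.
Qed.

End approximation.

(** * Iterates of an admissible family *)

Section weighted_norm.
Context {R : realType} {d : nat}.
Variable kappa : 'rV[R]_d -> R.
Hypothesis hkappa : is_weight kappa.
Implicit Types (f g : 'rV[R]_d -> R).

Lemma kappa_norm_leP f (c : R) :
  (kappa_norm kappa f <= c%:E)%E <-> forall x, `|f x| * kappa x <= c.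
Proof.
split=> [H x|H].
  by rewrite -lee_fin (le_trans _ H)//; apply: ereal_sup_ubound; exists x.
by apply: ge_ereal_sup => _ [x _ <-]; rewrite lee_fin.
Qed.

Lemma weight_ge0 x : 0 <= kappa x.
Proof. by have /andP[/ltW] := weight_itv hkappa x. Qed.

Lemma le_mul_weight f (c : R) x : `|f x| <= c -> `|f x| * kappa x <= c.
Proof.
move=> fc; rewrite (le_trans _ fc)// ler_piMr//.
by have /andP[] := weight_itv hkappa x.
Qed.

Lemma bounded_C_kappa f (c : R) : continuous f -> (forall x, `|f x| <= c) -> C_kappa kappa f.
Proof.
move=> cf fc; split=> //; apply: le_lt_trans (ltry c).
by apply/kappa_norm_leP => x; exact: le_mul_weight.
Qed.

Lemma kappa_norm_trans f g u (a b : R) :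
  (forall x, `|f x - g x| * kappa x <= a) -> (forall x, `|g x - u x| * kappa x <= b) ->
  forall x, `|f x - u x| * kappa x <= a + b.
Proof.
move=> fg gu x; rewrite (le_trans _ (lerD (fg x) (gu x)))// -mulrDl.
by rewrite ler_wpM2r ?weight_ge0// ler_distD.
Qed.

Lemma Lip_b_bounded r f : Lip_b r f -> forall x, `|f x| <= r.
Proof. by case=> _ /sup_norm_leP. Qed.

Lemma Lip_b_C_kappa r f : Lip_b r f -> C_kappa kappa f.
Proof.
move=> fr; apply: (@bounded_C_kappa _ r); last exact: Lip_b_bounded fr.
exact: (lipschitz_enorm_continuous fr.1).
Qed.

End weighted_norm.

Section admissible_family.
Context {R : realType} {d : nat}.
Variable kappa : 'rV[R]_d -> R.
Hypothesis hkappa : is_weight kappa.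
Variables (h : nat -> R) (omega t0 eps0 L : R) (I : R -> ('rV[R]_d -> R) -> 'rV[R]_d -> R).
Hypothesis hI : admissible kappa h omega t0 eps0 L I.
Hypothesis homega : 0 <= omega.
Variable hn : R.
Hypothesis hn01 : 0 < hn <= 1.
Implicit Types (f g : 'rV[R]_d -> R) (m : nat).
Let Im m f := iter m (I hn) f.
Let E := expR (omega * hn).

Let hn0 : 0 <= hn. Proof. by case/andP: hn01 => /ltW. Qed.
Let E1 : 1 <= E. Proof. by rewrite -expR0 ler_expR mulr_ge0. Qed.
Let E0 : 0 <= E. Proof. exact: expR_ge0. Qed.

Lemma iter_C_kappa m f : C_kappa kappa f -> C_kappa kappa (Im m f).
Proof. by move=> Cf; elim: m => // m IH; exact: (adm_stable hI hn0 IH). Qed.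

Lemma iter_Lip_b m f r : 0 <= r -> Lip_b r f -> Lip_b (E ^+ m * r) (Im m f).
Proof.
move=> r0 fr; elim: m => [|m IH]; first by rewrite expr0 mul1r.
rewrite exprS -mulrA; apply: (adm_Lip hI _ hn0 IH).
by rewrite mulr_ge0 ?exprn_ge0.
Qed.

Lemma iter_contraction m f g (c : R) : C_kappa kappa f -> C_kappa kappa g ->
  (forall x, `|f x - g x| * kappa x <= c) ->
  forall x, `|Im m f x - Im m g x| * kappa x <= E ^+ m * c.
Proof.
move=> Cf Cg fg; elim: m => [|m IH]; first by rewrite expr0 mul1r.
apply/(@kappa_norm_leP _ _ _ (Im m.+1 f \- Im m.+1 g)).
have t01 : 0 <= hn <= 1 by case/andP: hn01 => /ltW -> ->.
apply: le_trans (adm_lipschitz hI t01 (iter_C_kappa m Cf) (iter_C_kappa m Cg)) _.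
rewrite exprS -mulrA EFinM lee_wpmul2l ?lee_fin//.
exact/(@kappa_norm_leP _ _ _ (Im m f \- Im m g)).
Qed.

(** Telescoping: each of the [m] increments is the one-step error [e] carried through fewer than [m]
    further steps, at a cost of at most [E ^+ m]. *)
Lemma iter_sub_id m g (e : R) : C_kappa kappa g -> 0 <= e ->
  (forall x, `|I hn g x - g x| * kappa x <= e) ->
  forall x, `|Im m g x - g x| * kappa x <= m%:R * E ^+ m * e.
Proof.
move=> Cg e0 ge; elim: m => [|m IH] x.
  by rewrite subrr normr0 !mul0r.
have H1 := @iter_contraction m _ _ _ (iter_C_kappa 1 Cg) Cg ge.
have -> : Im m.+1 g = Im m (Im 1 g) by rewrite /Im iterSr.
apply: (le_trans (kappa_norm_trans hkappa H1 IH x)).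
rewrite -mulrA -{1}(mul1r (E ^+ m * e)) -mulrDl nat1r -mulrA ler_wpM2l ?ler0n//.
by rewrite ler_wpM2r// exprS ler_peMl// exprn_ge0.
Qed.

Variables (T r : R) (f : 'rV[R]_d -> R).
Hypotheses (r0 : 0 <= r) (fr : Lip_b r f).

Let ET k : k%:R * hn <= T -> E ^+ k <= expR (omega * T).
Proof.
by move=> kT; rewrite /E -expRM_natl ler_expR mulrCA ler_wpM2l.
Qed.

Lemma iter_sub_iter_trivial k l : k%:R * hn <= T -> l%:R * hn <= T ->
  forall x, `|Im k f x - Im l f x| * kappa x <= expR (omega * T) * (2 * r).
Proof.
move=> kT lT x; apply: (@le_mul_weight _ _ _ hkappa (Im k f \- Im l f)).
have H j : j%:R * hn <= T -> `|Im j f x| <= expR (omega * T) * r.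
  move=> jT; apply: le_trans (Lip_b_bounded (iter_Lip_b j r0 fr) x) _.
  by rewrite ler_wpM2r// ET.
rewrite (le_trans (ler_normB _ _))// mulrCA mulr2n mulrDl mul1r.
by rewrite lerD ?H.
Qed.

(** The common [l] steps are removed by the Lipschitz bound, then [g] is inserted on both sides.
    Here [delta] is the uniform distance from [g] to [f], later [r] times the mollification
    scale. *)
Lemma iter_sub_iter_smooth m l g (e delta : R) : (m + l)%:R * hn <= T ->
  C_kappa kappa g -> 0 <= e -> 0 <= delta -> (forall x, `|g x - f x| <= delta) ->
  (forall x, `|I hn g x - g x| * kappa x <= e * hn) ->
  forall x, `|Im (m + l) f x - Im l f x| * kappa x <=
    expR (omega * T) * (2 * delta + m%:R * hn * e).
Proof.
move=> mlT Cg e0 dl0 gf gI.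
have Cf := Lip_b_C_kappa hkappa fr.
have fg x : `|f x - g x| * kappa x <= delta.
  by apply: (@le_mul_weight _ _ _ hkappa (f \- g)) => /=; rewrite distrC.
have gf' x : `|g x - f x| * kappa x <= delta.
  by apply: (@le_mul_weight _ _ _ hkappa (g \- f)); exact: gf.
have H1 := @iter_contraction m _ _ _ Cf Cg fg.
have H2 := @iter_sub_id m g _ Cg (mulr_ge0 e0 hn0) gI.
have H3 := kappa_norm_trans hkappa (kappa_norm_trans hkappa H1 H2) gf'.
have H4 := @iter_contraction l _ _ _ (iter_C_kappa m Cf) Cf H3.
move=> x; have -> : Im (m + l) f = Im l (Im m f) by rewrite /Im addnC iterD.
apply: (le_trans (H4 x)).
apply: (@le_trans _ _ (E ^+ l * (E ^+ m * (2 * delta + m%:R * hn * e)))).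
  rewrite ler_wpM2l ?exprn_ge0//.
  (* The distance to [f] enters once with the factor [E ^+ m] and once without; enlarging the latter
     gives [2 * delta]. *)
  have Em : 1 <= E ^+ m by rewrite exprn_ege1.
  have : delta <= E ^+ m * delta by rewrite ler_peMl.
  have -> : m%:R * E ^+ m * (e * hn) = E ^+ m * (m%:R * hn * e).
    by ring.
  lra.
rewrite mulrA -exprD addnC ler_wpM2r ?ET//.
by rewrite addr_ge0// !mulr_ge0.
Qed.

End admissible_family.

(** * The Hoelder estimate *)

(** Because [1 - p / (1 + p) = 1 / (1 + p)], the second-derivative cost times [tau] has the same
    order as the approximation error. This is the origin of [alpha]. *)
Lemma mulr_powR_exponent (R : realType) (tau p b : R) : 0 < tau -> 0 <= p -> 0 <= b ->
  tau * (b / tau `^ (1 + p)^-1) `^ p = b `^ p * tau `^ (1 + p)^-1.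
Proof.
move=> tau0 p0 b0; have p1 : 1 + p != 0 by rewrite gt_eqF// ltr_pwDl.
rewrite -powRN powRM ?powR_ge0// -powRrM mulrCA; congr (_ * _).
rewrite -{1}(powRr1 (ltW tau0)) -powRD; last by apply/implyP => _; rewrite gt_eqF.
by congr (_ `^ _); field.
Qed.

(** As [1 + h / a >= 1] and [q <= 1], its power is at most the base itself. The right-hand side is
    affine in [h], which makes the limit [h n --> 0] elementary. *)
Lemma powRD_le (R : realType) (a h q : R) : 0 < a -> 0 <= h -> 0 <= q <= 1 ->
  (a + h) `^ q <= a `^ q * (1 + h / a).
Proof.
move=> a0 h0 /andP[q0 q1].
have ha : 0 <= h / a by rewrite divr_ge0// ltW.
have -> : a + h = a * (1 + h / a) by field; rewrite gt_eqF.
rewrite powRM ?addr_ge0// ?(ltW a0)//; apply: ler_wpM2l; first exact: powR_ge0.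
by rewrite -[leRHS]powRr1 ?addr_ge0// ler_powR// lerDl.
Qed.

(** Singletons are compact. Pointwise limits suffice later, since a bound on the weighted norm is
    tested point by point. *)
Lemma mixed_cvg_pointwise (R : realType) d (kappa : 'rV[R]_d -> R) u g x :
  mixed_cvg kappa u g -> u n x @[n --> \oo] --> g x.
Proof.
move=> [_ /(_ [set x] (@compact_set1 _ x)) H].
by rewrite uniform_set1 in H.
Qed.

(** Each rounding loses an amount in [[0, hn[], so the two losses differ by less than [hn]. *)
Lemma dist_nsteps (R : realType) (hn s t : R) : 0 < hn -> 0 <= s -> 0 <= t ->
  `|(nsteps hn s)%:R - (nsteps hn t)%:R| * hn <= `|s - t| + hn.
Proof.
move=> h0.
have H u : 0 <= u -> (nsteps hn u)%:R * hn <= u < (nsteps hn u)%:R * hn + hn.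
  move=> u0; rewrite -nstepsP// leqnn/= -{3}[hn]mul1r -mulrDl natr1 ltNge -nstepsP//.
  by rewrite ltnn.
move=> /H/andP[s1 s2] /H/andP[t1 t2].
rewrite -[X in _ * X <= _](gtr0_norm h0) -normrM mulrBl ler_norml.
have := ler_norm (s - t); have := ler_norm (t - s); rewrite distrC => A B.
by apply/andP; split; lra.
Qed.

Section holder_estimate.
Context {R : realType} {d : nat}.
Variables (kappa : 'rV[R]_d -> R) (eta : R -> 'rV[R]_d -> R).
Hypotheses (d0 : (0 < d)%N) (hkappa : is_weight kappa) (heta : is_mollifier eta).
Variables (h : nat -> R) (omega t0 eps0 L : R) (I : R -> ('rV[R]_d -> R) -> 'rV[R]_d -> R).
Hypotheses (hI : admissible kappa h omega t0 eps0 L I) (homega : 0 <= omega).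
Variable hn : R.
Hypothesis hn01 : 0 < hn <= 1.
Variable rho1 : R -> R -> R.
Hypothesis rho1_mono : forall x x' y y', 0 <= x -> x <= x' -> 0 <= y -> y <= y' ->
  rho1 x y <= rho1 x' y'.
Hypothesis hrho1 : forall f, Cb_smooth f ->
  (kappa_norm kappa (I hn f \- f)%R <=
     (rho1 ((Num.sqrt d%:R)^-1 * fine (Dnorm 1 f)) (d%:R^-1 * fine (Dnorm 2 f)) * hn)%:E)%E.
Variables (a1 : R -> R) (a2 p : R).
Hypotheses (ha1 : forall x, 0 <= x -> 0 <= a1 x) (ha2 : 0 <= a2) (hp : 0 <= p).
Hypothesis rho1_growth : forall x1 x2, 1 <= x1 -> 1 <= x2 -> rho1 x1 x2 <= a1 x1 + a2 * x2 `^ p.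
Variables (r T : R) (f : 'rV[R]_d -> R).
Hypotheses (hr : 1 <= r) (fr : Lip_b r f).
Let A := 2 * r + a1 r + a2 * b01 eta `^ p * r `^ p.
Let alpha := (1 + p)^-1.
Let r0 : 0 <= r. Proof. exact: le_trans hr. Qed.
Let h0 : 0 < hn. Proof. by case/andP: hn01. Qed.
Let b1 : 1 <= b01 eta. Proof. exact: b01_ge1. Qed.
Let b0 : 0 <= b01 eta. Proof. exact: le_trans b1. Qed.
Let p1 : 0 < 1 + p. Proof. by rewrite ltr_pwDl. Qed.
Let alpha0 : 0 < alpha. Proof. by rewrite invr_gt0. Qed.
Let alpha1 : alpha <= 1. Proof. by rewrite invf_le1// lerDl. Qed.

Lemma holder_constant_ge : 2 * r <= A.
Proof. by rewrite /A -addrA lerDl addr_ge0 ?ha1// !mulr_ge0 ?powR_ge0. Qed.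

Let A0 : 0 <= A. Proof. by rewrite (le_trans _ holder_constant_ge)// mulr_ge0. Qed.

Lemma iter_sub_iter_le m l : (m + l)%:R * hn <= T ->
  forall x, `|iter (m + l) (I hn) f x - iter l (I hn) f x| * kappa x <=
    expR (omega * T) * A * (m%:R * hn) `^ alpha.
Proof.
move=> mlT x.
(* For [m = 0] the mollification scale would be 0, so this case is separate. *)
have [->|m0] := eqVneq m 0%N.
  by rewrite add0n subrr normr0 mul0r !mulr_ge0 ?expR_ge0 ?powR_ge0.
set tau := m%:R * hn.
have tau0 : 0 < tau by rewrite mulr_gt0// ltr0n lt0n.
have lT : l%:R * hn <= T.
  by rewrite (le_trans _ mlT)// ler_wpM2r ?(ltW h0)// ler_nat leq_addl.
rewrite -mulrA.
have [tau1|/ltW tau1] := leP tau 1; last first.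
  apply: le_trans (iter_sub_iter_trivial hkappa hI homega hn01 r0 fr mlT lT x) _.
  rewrite ler_wpM2l ?expR_ge0// (le_trans holder_constant_ge)// ler_peMr//.
  by rewrite -(powRr0 tau) ler_powR// ltW.
set delta := tau `^ alpha.
have delta0 : 0 < delta by rewrite powR_gt0.
have delta1 : delta <= 1.
  apply: (@le_trans _ _ (1 `^ alpha)); last by rewrite powR1.
  by rewrite ge0_ler_powR ?nnegrE// ltW.
have [f_lip _] := fr; have fB := Lip_b_bounded fr.
pose g := mollify delta f (eta_kernel eta [::]).
have Cg : Cb_smooth g := Cb_smooth_mollify heta delta0 f_lip fB.
have [D10 D1] := andP (mollify_Dnorm1 heta d0 r0 delta0 f_lip fB).
have [D20 D2] := andP (mollify_Dnorm2 heta d0 r0 delta0 f_lip fB).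
have Ckg : C_kappa kappa g.
  have [sm /(_ [::])/= bd] := Cg; have [/= cg _] := sm [::].
  have bf : sup_norm g \is a fin_num by rewrite ge0_fin_numE ?sup_norm_ge0.
  apply: (@bounded_C_kappa _ _ _ hkappa g (fine (sup_norm g)) cg).
  by apply/sup_norm_leP; rewrite fineK.
(* The growth bound of [rho1] at [r] and [r * b01 eta / delta], the bounds for the two normalised
   derivative norms of [g]. *)
pose e := a1 r + a2 * (r * b01 eta / delta) `^ p.
have e0 : 0 <= e by rewrite addr_ge0 ?ha1// mulr_ge0// powR_ge0.
have gI : forall y, `|I hn g y - g y| * kappa y <= e * hn.
  apply/(@kappa_norm_leP _ _ _ (I hn g \- g)).
  apply: le_trans (hrho1 Cg) _; rewrite lee_fin ler_wpM2r ?(ltW h0)//.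
  apply: le_trans (rho1_mono D10 D1 D20 D2) _.
  by apply: rho1_growth => //; rewrite ler_pdivlMr// mul1r (le_trans delta1)// mulr_ege1.
have H := iter_sub_iter_smooth hkappa hI homega hn01 fr mlT Ckg e0 (mulr_ge0 r0 (ltW delta0))
  (mollify_close heta r0 delta0 f_lip fB) gI.
apply: le_trans (H x) _; rewrite ler_wpM2l ?expR_ge0//.
rewrite -/tau /e mulrDr (mulrCA tau) mulr_powR_exponent ?mulr_ge0//.
rewrite -/alpha -/delta powRM// /A.
(* From [tau <= 1] and [alpha <= 1] follows [tau <= delta], so the first-order term is also of order
   [delta]. *)
have : tau * a1 r <= delta * a1 r.
  rewrite ler_wpM2r ?ha1// -[leLHS]powRr1 ?(ltW tau0)// /delta.
  by rewrite ger_powR// tau0.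
have -> : a2 * (r `^ p * b01 eta `^ p * delta) = a2 * b01 eta `^ p * r `^ p * delta by ring.
by move=> ?; lra.
Qed.

Lemma iter_dist_le k l : k%:R * hn <= T -> l%:R * hn <= T ->
  forall x, `|iter k (I hn) f x - iter l (I hn) f x| * kappa x <=
    expR (omega * T) * A * (`|k%:R - l%:R| * hn) `^ alpha.
Proof.
move=> kT lT x; wlog lk : k l kT lT / (l <= k)%N => [H|].
  have [/H->//|/ltnW/H H'] := leqP l k.
  by rewrite distrC [X in _ <= _ * (X * _) `^ _]distrC; exact: H'.
have := @iter_sub_iter_le (k - l) l; rewrite subnK// => /(_ kT x).
have -> // : `|k%:R - l%:R| = (k - l)%:R :> R.
by rewrite natrB// ger0_norm// subr_ge0 ler_nat.
Qed.

(** The section fixes one step size [hn]; the equation [h n = hn] ties it to the sequence, and the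
    constant is the same for every [n]. *)
Lemma I_pi_dist_le n s t : h n = hn -> 0 <= s <= T -> 0 <= t <= T ->
  forall x, `|I_pi I h n s f x - I_pi I h n t f x| * kappa x <=
    expR (omega * T) * A * (`|s - t| + hn) `^ alpha.
Proof.
move=> hnE /andP[s0 sT] /andP[u0 uT] x; rewrite /I_pi hnE.
have kT u : 0 <= u -> u <= T -> (nsteps hn u)%:R * hn <= T.
  by move=> uge0; apply: le_trans; rewrite -nstepsP.
apply: le_trans (iter_dist_le (kT _ s0 sT) (kT _ u0 uT) x) _.
rewrite ler_wpM2l ?mulr_ge0 ?expR_ge0// ge0_ler_powR ?nnegrE ?(ltW alpha0)//.
- by rewrite mulr_ge0// ltW.
- by rewrite addr_ge0// ltW.
- exact: dist_nsteps.
Qed.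

End holder_estimate.
Theorem corollary2p12 (R : realType) (d : nat) (hd : (0 < d)%N)
  (kappa : 'rV[R]_d -> R) (hkappa : is_weight kappa)
  (eta : R -> 'rV[R]_d -> R) (heta : is_mollifier eta)
  (h : nat -> R) (hh : step_sizes h)
  (omega t0 eps0 L : R) (homega : 0 <= omega) (ht0 : 0 < t0)
  (heps0 : 0 < eps0 <= 1) (hL : 0 <= L)
  (I : R -> ('rV[R]_d -> R) -> 'rV[R]_d -> R)
  (hI : admissible kappa h omega t0 eps0 L I)
  (rho1 : R -> R -> R)
  (hrho1_ge0 : forall x y, 0 <= x -> 0 <= y -> 0 <= rho1 x y)
  (hrho1_mono : forall x x' y y', 0 <= x -> x <= x' -> 0 <= y -> y <= y' ->
     rho1 x y <= rho1 x' y')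
  (hrho1 : forall (n : nat) (f : 'rV[R]_d -> R), Cb_smooth f ->
     (kappa_norm kappa (I (h n) f \- f)%R <=
       (rho1 ((Num.sqrt d%:R)^-1 * fine (Dnorm 1 f))
             (d%:R^-1 * fine (Dnorm 2 f)) * h n)%:E)%E)
  (a1 : R -> R) (a2 p : R)
  (ha1 : forall x, 0 <= x -> 0 <= a1 x) (ha2 : 0 <= a2) (hp : 0 <= p)
  (hrho1_growth : forall x1 x2, 1 <= x1 -> 1 <= x2 ->
     rho1 x1 x2 <= a1 x1 + a2 * x2 `^ p)
  (r T : R) (hr : 1 <= r) (hT : 0 <= T)
  (f : 'rV[R]_d -> R) (hf : Lip_b r f) :
  let c := expR (omega * T) * (2 * r + a1 r + a2 * b01 eta `^ p * r `^ p) in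
  let alpha := 1 / (1 + p) in
  [/\ forall k l n : nat, (0 < k)%N -> (0 < l)%N ->
        k%:R * h n <= T -> l%:R * h n <= T -> `|k%:R - l%:R| * h n <= 1 ->
        (kappa_norm kappa (iter k (I (h n)) f \- iter l (I (h n)) f)%R <=
          (c * (`|k%:R - l%:R| * h n) `^ alpha)%:E)%E,
      forall (n : nat) (s t : R), 0 <= s <= T -> 0 <= t <= T -> `|s - t| <= 1 ->
        (kappa_norm kappa (I_pi I h n s f \- I_pi I h n t f)%R <=
          (c * (`|s - t| + h n) `^ alpha)%:E)%E &
      forall S : R -> ('rV[R]_d -> R) -> 'rV[R]_d -> R,
        is_associated_semigroup kappa h I S ->
        forall s t : R, 0 <= s <= T -> 0 <= t <= T -> `|s - t| <= 1 ->
        (kappa_norm kappa (S s f \- S t f)%R <=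
          (c * `|s - t| `^ alpha)%:E)%E].
Proof.
move=> c alpha; have h01 := step_itv hh.
have alphaE : alpha = (1 + p)^-1 by rewrite /alpha div1r.
have hpi n := I_pi_dist_le hd hkappa heta hI homega (h01 n) hrho1_mono (hrho1 n)
  ha1 ha2 hp hrho1_growth hr hf (erefl (h n)).
have cA x : 0 <= x `^ alpha by exact: powR_ge0.
have c0 : 0 <= c.
  rewrite mulr_ge0 ?expR_ge0// (le_trans _ (holder_constant_ge eta p ha1 ha2 hr))//.
  by rewrite mulr_ge0// (le_trans _ hr).
split.
- move=> k l n _ _ kT lT _; apply/kappa_norm_leP => x; rewrite alphaE.
  exact: (iter_dist_le hd hkappa heta hI homega (h01 n) hrho1_mono (hrho1 n)
    ha1 ha2 hp hrho1_growth hr hf kT lT x).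
- by move=> n s t sT tT _; apply/kappa_norm_leP => x; rewrite alphaE; exact: hpi.
- move=> S HS s t sT tT _; apply/kappa_norm_leP => x /=.
  (* [powRD_le] divides by [|s - t|], so equal times are treated apart. *)
  have [<-|st] := eqVneq s t; first by rewrite subrr normr0 mul0r mulr_ge0.
  have st0 : 0 < `|s - t| by rewrite normr_gt0 subr_eq0.
  have Cf := Lip_b_C_kappa hkappa hf.
  have /andP[s0 _] := sT; have /andP[u0 _] := tT.
  have cs := @mixed_cvg_pointwise _ _ _ _ _ x (HS _ _ s0 Cf).
  have ct := @mixed_cvg_pointwise _ _ _ _ _ x (HS _ _ u0 Cf).
  have lhs : `|I_pi I h n s f x - I_pi I h n t f x| * kappa x @[n --> \oo] -->
      `|S s f x - S t f x| * kappa x.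
    by apply: cvgM; [apply: cvg_norm; exact: cvgB|exact: cvg_cst].
  (* The bound for [I_pi], made affine in [h n], tends to the bound claimed for [S]. *)
  have rhs : c * (`|s - t| `^ alpha * (1 + h n / `|s - t|)) @[n --> \oo] -->
      c * (`|s - t| `^ alpha * (1 + 0 / `|s - t|)).
    apply: cvgM; first exact: cvg_cst.
    apply: cvgM; first exact: cvg_cst.
    apply: cvgD; first exact: cvg_cst.
    by apply: cvgM; [exact: step_cvg0|exact: cvg_cst].
  rewrite mul0r addr0 mulr1 in rhs.
  apply: (ler_cvg_to lhs rhs); apply: nearW => n.
  apply: le_trans; first exact: (hpi _ _ _ _ sT tT).
  rewrite -alphaE -/c; apply: ler_wpM2l => //.
  apply: powRD_le => //; first by have /andP[/ltW] := h01 n.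
  by rewrite alphaE invr_ge0 addr_ge0//= invf_le1 ?lerDl// ltr_pwDl.
Qed.
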